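(* For each filtered space $X$ endowed with two perversities $\overline p$ and $\overline q$, the intersection cap product $$-\cap-\colon\widetilde N^*_{\overline p}(X;R)\otimes\mathfrak C^{\overline q}_m(X;R)\to\mathfrak C^{\overline p+\overline q}_{m-*}(X;R)$$ is well defined and induces a morphism $$-\cap-\colon\mathscr H^*_{\overline p}(X;R)\otimes\mathfrak H^{\overline q}_m(X;R)\to\mathfrak H^{\overline p+\overline q}_{m-*}(X;R).$$
   Context: $R$ is a commutative ring with unity. Filtered spaces. A filtered space is a Hausdorff space $X$ with a filtration by closed subspaces $\emptyset=X_{-1}\subseteq X_0\subseteq\dots\subseteq X_{n-1}\subsetneq X_n=X$; $n=\dim X$ is the formal dimension. Strata are the non-empty connected components of the $X_i\setminus X_{i-1}$; a stratum $S\subset X_i\setminus X_{i-1}$ has $\operatorname{codim}S=n-i$; it is regular if $\operatorname{codim}S=0$, singular otherwise. A perversity on $X$ is a map $\overline p$ from the set of strata to $\mathbb Z\cup\{\pm\infty\}$ with value $0$ on regular strata. $(\overline p+\overline q)(S)=\overline p(S)+\overline q(S)$, with the convention that the sum is $-\infty$ if one of the terms is $-\infty$. Filtered simplices. A filtered singular simplex is a continuous map $\sigma\colon\Delta\to X$ from a euclidean simplex (with ordered vertices) with a join decomposition $\Delta=\Delta_0*\dots*\Delta_n$ (some $\Delta_i$ may be empty), compatible with the vertex order, such that $\sigma^{-1}(X_i)=\Delta_0*\dots*\Delta_i$ for all $i$. It is regular if $\Delta_n\neq\emptyset$. A regular face operator is the inclusion $\delta_\ell\colon\nabla\to\Delta$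 of a codimension-one face with $\nabla_i=\nabla\cap\Delta_i$ and $\nabla_n\ne\emptyset$. Blow-up. For an ordered simplicial complex $K$, $N_*(K)$ is its simplicial chain complex over $R$, $N^*(K)=\operatorname{Hom}(N_*(K),R)$ with $(\delta f)(v)=-(-1)^{|f|}f(\partial v)$, and $\mathbf 1_F$ is the cochain equal to $1$ on the simplex $F$ and $0$ on the others. For a simplex $E$, $\mathtt cE=E*[\mathtt v]$ is the cone with apex $\mathtt v$ as last vertex ($\mathtt c\emptyset=[\mathtt v]$); its faces are written $(F,0)=F$ ($\emptyset\ne F$ a face of $E$) and $(F,1)=F*[\mathtt v]$ ($F$ a possibly empty face of $E$). Put $|(F,\varepsilon)|=\dim F+\varepsilon$, with $|(\emptyset,1)|=0$. For a regular simplex $\Delta$ put $\widetilde N^*(\Delta)=N^*(\mathtt c\Delta_0)\otimes\dots\otimes N^*(\mathtt c\Delta_{n-1})\otimes N^*(\Delta_n)$ with the tensor product differential and basis $\mathbf 1_{(F,\varepsilon)}=\mathbf 1_{(F_0,\varepsilon_0)}\otimes\dots\otimes\mathbf 1_{(F_{n-1},\varepsilon_{n-1})}\otimes\mathbf 1_{F_n}$ ($\varepsilon_n=0$, $F_n\neq\emptyset$). For $\ell\in\{1,\dots,n\}$, $\|\mathbf 1_{(F,\varepsilon)}\|_\ell=-\infty$ if $\varepsilon_{n-\ell}=1$ and $=\sum_{i>n-\ell}|(F_i,\varepsilon_i)|$ if $\varepsilon_{n-\ell}=0$; for a linear combination with non-zero coefficients take the maximum; $\|0\|_\ell=-\infty$.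 $\widetilde N^*(X;R)$ is the complex of families $\omega=(\omega_\sigma)_\sigma$ indexed by regular simplices $\sigma\colon\Delta\to X$, $\omega_\sigma\in\widetilde N^*(\Delta)$, with $\delta_\ell^*\omega_\sigma=\omega_{\sigma\circ\delta_\ell}$ for every regular face operator; $(\delta\omega)_\sigma=\delta(\omega_\sigma)$. For a singular stratum $S$, $\|\omega\|_S=\sup\{\|\omega_\sigma\|_{\operatorname{codim}S}: \sigma\text{ regular},\ \operatorname{im}\sigma\cap S\neq\emptyset\}$. $\omega$ is $\overline p$-allowable if $\|\omega\|_S\le\overline p(S)$ for all singular $S$. $\widetilde N^*_{\overline p}(X;R)$ is the complex of $\omega$ with $\omega,\delta\omega$ both $\overline p$-allowable; its cohomology is the blown-up intersection cohomology $\mathscr H^*_{\overline p}(X;R)$. Tame intersection homology. $\mathfrak C_*(X;R)$ is the complex freely generated by regular simplices with differential $\mathfrak d\sigma$ = the sum of the terms of $\partial\sigma$ which are regular simplices. A filtered simplex $\sigma\colon\Delta\to X$ is $\overline q$-allowable if for each stratum $S$ with $S\cap\operatorname{im}\sigma\ne\emptyset$, $\dim(\Delta_0*\dots*\Delta_{n-\operatorname{codim}S})\le\dim\Delta-\operatorname{codim}S+\overline q(S)$ (with $\dim\emptyset=-\infty$). $\mathfrak C^{\overline q}_*(X;R)\subset\mathfrak C_*(X;R)$ is the subcomplex of chains $\xi$ such that $\xi$ and $\mathfrak d\xi$ are linear combinations of regular $\overline q$-allowable simplices; its homology is $\mathfrak H^{\overline q}_*(X;R)$. Cap product. Ordered simplices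 $F=[a_0,\dots,a_k]$, $G=[b_0,\dots,b_\ell]$ are compatible if $a_k=b_0$, and then $F\cup G=[a_0,\dots,a_k,b_1,\dots,b_\ell]$. For a simplex $\Delta$, $\mathbf 1_F\cap[\Delta]=G$ if $G$ is the face with $F\cup G=\Delta$, and $0$ if there is none. For the cone, $\mathbf 1_{(F,j)}\cap[\mathtt c\Delta]=(G,1)$ where $F\cup G=\Delta$ if $j=0$ (and $0$ if no such $G$), $=(\emptyset,1)$ if $(F,j)=(\Delta,1)$, and $0$ otherwise. For a regular simplex $\Delta$ of dimension $d$, $\mathbf 1_{(F,\varepsilon)}\,\widetilde\cap\,\widetilde\Delta=(-1)^{\nu}(\mathbf 1_{(F_0,\varepsilon_0)}\cap[\mathtt c\Delta_0])\otimes\dots\otimes(\mathbf 1_{(F_{n-1},\varepsilon_{n-1})}\cap[\mathtt c\Delta_{n-1}])\otimes(\mathbf 1_{F_n}\cap[\Delta_n])$ with $\nu=\sum_{j=0}^{n-1}(\dim\Delta_j+1)\sum_{i>j}|(F_i,\varepsilon_i)|$ (here $\dim\emptyset=-1$). Let $\mu_*\big(\bigotimes_{k<n}(F_k,\varepsilon_k)\otimes F_n\big)=F_0*\dots*F_\ell$ if $\sum_{i}|(F_i,\varepsilon_i)|=\dim(F_0*\dots*F_\ell)$ and $0$ otherwise, where $\ell$ is the smallest $j$ with $\varepsilon_j=0$ ($\varepsilon_n=0$). Put $c\cap\widetilde\Delta=\mu_*(c\,\widetilde\cap\,\widetilde\Delta)\in N_{d-*}(\Delta)$, and $\omega\cap\sigma=\sigma_*(\omega_\sigma\cap\widetilde\Delta)$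 for $\omega\in\widetilde N^*(X;R)$ and $\sigma\colon\Delta\to X$ regular, extended linearly. The cap product in the claim is the restriction of this operation. *)

(* Defs.v *)
From HB Require Import structures.
From mathcomp Require Import all_boot all_order all_algebra generic_quotient finmap.
From mathcomp Require Import all_classical all_reals all_analysis.

Set Implicit Arguments.
Unset Strict Implicit.
Unset Printing Implicit Defensive.

Import Order.TTheory GRing.Theory Num.Theory.
Import numFieldNormedType.Exports.

Local Open Scope classical_set_scope.
Local Open Scope ring_scope.

Section Submodule.
Variables (R : pzRingType) (V : lmodType R) (S : submodClosed V).

Record submod := Submod { submod_val :> V; _ : submod_val \in S }.

HB.instance Definition _ := [isSub for submod_val].
HB.instance Definition _ := [Choice of submod by <:].
HB.instance Definition _ := [SubChoice_isSubLmodule of submod by <:].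

End Submodule.

Section Subquotient.
Variables (R : pzRingType) (V : lmodType R) (Z B : submodClosed V).

Definition subquot_rel (x y : submod Z) := val x - val y \in B.

Lemma submodClosedN (S : submodClosed V) (u : V) : (- u \in S) = (u \in S).
Proof.
apply/idP/idP => uS; last by rewrite -scaleN1r rpredZ.
by rewrite -[u]opprK -scaleN1r rpredZ.
Qed.

Lemma subquot_rel_equiv : equiv_class_of subquot_rel.
Proof.
split=> [x|x y|y x z]; rewrite /subquot_rel.
- by rewrite subrr rpred0.
- by rewrite -submodClosedN opprB.
- by move=> xy yz; rewrite -(subrKA (val y)) rpredD.
Qed.

Canonical subquot_equiv := EquivRelPack subquot_rel_equiv.
Canonical subquot_enc := defaultEncModRel subquot_rel.

(* Z / (Z intersected with B), which is Z / B as soon as B is contained in Z. *)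
Definition subquot := {eq_quot subquot_rel}%qT.
HB.instance Definition _ := Quotient.on subquot.
HB.instance Definition _ := Choice.on subquot.
HB.instance Definition _ : EqQuotient _ subquot_rel subquot :=
  EqQuotient.on subquot.

Definition subquot_class (x : submod Z) : subquot := (\pi_subquot x)%qT.

Lemma subquot_classP x y :
  reflect (subquot_class x = subquot_class y) (val x - val y \in B).
Proof. by apply: (iffP idP) => [h|/eqmodP //]; apply/eqmodP. Qed.

Lemma subquot_classK (x : subquot) : subquot_class (repr x) = x.
Proof. exact: reprK. Qed.

Local Notation C := subquot_class.

Lemma subquotW (P : subquot -> Prop) : (forall v, P (C v)) -> forall x, P x.
Proof. by move=> PC x; rewrite -(subquot_classK x). Qed.

Let CP x y : val x - val y \in B -> C x = C y. Proof. by move/subquot_classP. Qed.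
Let reprC x : val (repr (C x)) - val x \in B.
Proof. by apply/subquot_classP; rewrite subquot_classK. Qed.

Definition subquot_add (x y : subquot) := C (repr x + repr y).
Definition subquot_opp (x : subquot) := C (- repr x).
Definition subquot_scale (a : R) (x : subquot) := C (a *: repr x).

Lemma subquot_addE x y : subquot_add (C x) (C y) = C (x + y).
Proof.
apply: CP; have := rpredD (reprC x) (reprC y).
by rewrite addrACA -opprD -!raddfD.
Qed.

Lemma subquot_oppE x : subquot_opp (C x) = C (- x).
Proof.
apply: CP; have e : val (- repr (C x)) - val (- x) = - (val (repr (C x)) - val x).
  by rewrite opprD !raddfN.
by rewrite e submodClosedN.
Qed.

Lemma subquot_scaleE a x : subquot_scale a (C x) = C (a *: x).
Proof.
apply: CP; have e : val (a *: repr (C x)) - val (a *: x) =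
    a *: (val (repr (C x)) - val x) by rewrite scalerBr !linearZ.
by rewrite e rpredZ.
Qed.

Lemma subquot_addA : associative subquot_add.
Proof.
elim/subquotW => x; elim/subquotW => y; elim/subquotW => z.
by rewrite (subquot_addE x y) (subquot_addE y z) !subquot_addE addrA.
Qed.

Lemma subquot_addC : commutative subquot_add.
Proof. by move=> x y; rewrite /subquot_add addrC. Qed.

Lemma subquot_add0 : left_id (C 0) subquot_add.
Proof. by elim/subquotW => x; rewrite subquot_addE add0r. Qed.

Lemma subquot_addN : left_inverse (C 0) subquot_opp subquot_add.
Proof. by elim/subquotW => x; rewrite subquot_oppE subquot_addE addNr. Qed.

HB.instance Definition _ := GRing.isZmodule.Build subquot
  subquot_addA subquot_addC subquot_add0 subquot_addN.

Lemma subquot_classD x y : C (x + y) = C x + C y.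
Proof. by rewrite -[RHS]/(subquot_add _ _) subquot_addE. Qed.

Lemma subquot_scaleA a b x :
  subquot_scale a (subquot_scale b x) = subquot_scale (a * b) x.
Proof.
elim/subquotW: x => x.
by rewrite (subquot_scaleE b x) !subquot_scaleE scalerA.
Qed.

Lemma subquot_scale1 : left_id 1 subquot_scale.
Proof. by elim/subquotW => x; rewrite subquot_scaleE scale1r. Qed.

Lemma subquot_scaleDr : right_distributive subquot_scale +%R.
Proof.
move=> a; elim/subquotW => x; elim/subquotW => y.
rewrite -subquot_classD (subquot_scaleE a x) (subquot_scaleE a y).
by rewrite (subquot_scaleE a (x + y)) scalerDr subquot_classD.
Qed.

Lemma subquot_scaleDl x : {morph subquot_scale^~ x : a b / a + b}.
Proof.
elim/subquotW: x => x a b.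
rewrite (subquot_scaleE a x) (subquot_scaleE b x) (subquot_scaleE (a + b) x).
by rewrite scalerDl subquot_classD.
Qed.

HB.instance Definition _ := GRing.Zmodule_isLmodule.Build R subquot
  subquot_scaleA subquot_scale1 subquot_scaleDr subquot_scaleDl.

Lemma subquot_class_linear : linear subquot_class.
Proof. by move=> a x y; rewrite subquot_classD -subquot_scaleE. Qed.

HB.instance Definition _ := GRing.isLinear.Build R (submod Z) subquot _
  subquot_class subquot_class_linear.

End Subquotient.

(* An R-bilinear map U x V -> W, i.e. an R-linear map on the tensor product. *)
Definition bilinear_map (R : pzRingType) (U V W : lmodType R)
    (f : U -> V -> W) : Prop :=
  (forall v, linear (f^~ v)) /\ (forall u, linear (f u)).

Section Families.
Variables (R : pzRingType) (I : Type) (V : I -> lmodType R).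

Definition families := forall i, V i.
HB.instance Definition _ := Choice.on families.

Implicit Types (f g h : families).
Let famE f g : (forall i, f i = g i) -> f = g.
Proof. by move=> fg; apply: functional_extensionality_dep. Qed.

Definition fam_zero : families := fun i => 0.
Definition fam_opp f : families := fun i => - f i.
Definition fam_add f g : families := fun i => f i + g i.
Definition fam_scale a f : families := fun i => a *: f i.

Lemma fam_addA : associative fam_add.
Proof. by move=> f g h; apply: famE => i; apply: addrA. Qed.
Lemma fam_addC : commutative fam_add.
Proof. by move=> f g; apply: famE => i; apply: addrC. Qed.
Lemma fam_add0 : left_id fam_zero fam_add.
Proof. by move=> f; apply: famE => i; apply: add0r. Qed.
Lemma fam_addN : left_inverse fam_zero fam_opp fam_add.
Proof. by move=> f; apply: famE => i; apply: addNr. Qed.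

HB.instance Definition _ :=
  GRing.isZmodule.Build families fam_addA fam_addC fam_add0 fam_addN.

Lemma fam_scaleA a b f : fam_scale a (fam_scale b f) = fam_scale (a * b) f.
Proof. by apply: famE => i; apply: scalerA. Qed.
Lemma fam_scale1 : left_id 1 fam_scale.
Proof. by move=> f; apply: famE => i; apply: scale1r. Qed.
Lemma fam_scaleDr : right_distributive fam_scale +%R.
Proof. by move=> a f g; apply: famE => i; apply: scalerDr. Qed.
Lemma fam_scaleDl f : {morph fam_scale^~ f : a b / a + b}.
Proof. by move=> a b; apply: famE => i; apply: scalerDl. Qed.

HB.instance Definition _ := GRing.Zmodule_isLmodule.Build R families
  fam_scaleA fam_scale1 fam_scaleDr fam_scaleDl.

End Families.

Section FreeModule.
Variables (R : pzRingType) (T : choiceType).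

Definition finite_support : {pred T -> R^o} :=
  [pred f | `[< finite_set [set t | f t != 0] >]].

Lemma finite_support_submod : submod_closed finite_support.
Proof.
split=> [|a f g].
  rewrite inE.
  by apply: (@sub_finite_set _ _ set0) => // t /=; rewrite eqxx.
rewrite !inE => f_fin g_fin.
apply: (@sub_finite_set _ _ ([set t | f t != 0] `|` [set t | g t != 0])).
  move=> t /= h; case: (eqVneq (f t) 0) => [ft|]; [right | by left].
  by apply: contra_neq h => gt; rewrite -[LHS]/(a *: f t + g t) ft gt scaler0 addr0.
by rewrite finite_setU.
Qed.

HB.instance Definition _ :=
  GRing.isSubmodClosed.Build R (T -> R^o) finite_support finite_support_submod.

Definition freemod := submod finite_support.

End FreeModule.

Definition freemod_fun (R : pzRingType) (T : choiceType) (x : freemod R T) :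
  T -> R := val x.
Coercion freemod_fun : freemod >-> Funclass.

Section LinearExtension.
Variables (R : pzRingType) (T : choiceType).
Implicit Types (x y : freemod R T).

Lemma freemod_basis_subproof (t : T) :
  (fun u => (u == t)%:R : R^o) \in @finite_support R T.
Proof.
rewrite inE; apply: (@sub_finite_set _ _ [set t]) => // u /=.
by case: (eqVneq u t) => //= _; rewrite eqxx.
Qed.

Definition basis (t : T) : freemod R T := Submod (freemod_basis_subproof t).

Variables (V : lmodType R) (f : T -> V).

Definition linext x : V := \sum_(t \in [set: T]) x t *: f t.

Lemma linextE x (A : set T) : finite_set A -> (forall t, x t != 0 -> A t) ->
  linext x = \sum_(t <- fset_set A) x t *: f t.
Proof.
move=> A_fin xA; rewrite /linext -(@fsbig_widen _ _ _ _ A) //.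
  by rewrite fsbig_finite.
move=> t [_ /= nAt]; have /eqP -> : x t == 0 by apply: contra_notT nAt => /xA.
by rewrite scale0r.
Qed.

Lemma freemod_finite x : finite_set [set t | x t != 0].
Proof. by have := valP x; rewrite inE. Qed.

Lemma linext_linear : linear linext.
Proof.
move=> a x y; pose c z := @freemod_fun R T z.
pose A := [set t | c x t != 0] `|` [set t | c y t != 0].
have A_fin : finite_set A by rewrite finite_setU; split; exact: freemod_finite.
have xyE t : c (a *: x + y) t = a * c x t + c y t.
  rewrite /c /freemod_fun.
  by have -> : val (a *: x + y) = a *: val x + val y by rewrite linearP.
have Axy t : c (a *: x + y) t != 0 -> A t.
  move=> h; case: (eqVneq (c x t) 0) => [xt|]; [right | by left].
  by apply: contra_neq h => yt; rewrite xyE xt yt mulr0 addr0.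
rewrite !(@linextE _ A) //=; [|by right|by left].
rewrite scaler_sumr -big_split /=; apply: eq_bigr => t _.
by rewrite -/(c _ _) xyE scalerDl scalerA.
Qed.

HB.instance Definition _ :=
  GRing.isLinear.Build R (freemod R T) V _ linext linext_linear.

End LinearExtension.

Lemma supremum_bareint_le (A : set (\bar int)) (y : \bar int) :
  (supremum -oo%E A <= y)%E <-> (forall x, A x -> (x <= y)%E).
Proof.
have supA : supremums A !=set0.
  case: (pselect (exists M : int, forall x, A x -> (x <= M%:E)%E)) => [[M MA]|noM]; last first.
    exists +oo%E; split=> [x _|z zA]; first by rewrite leey.
    case: z zA => [M MA||MA]; [|by []|].
      by exfalso; apply: noM; exists M.
    by exfalso; apply: noM; exists 0 => x /MA; rewrite leeNy_eq => /eqP ->.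
  case: (pselect (exists i : int, A i%:E)) => [[i Ai]|noi]; last first.
    exists -oo%E; split=> [x Ax|z _]; last by rewrite leNye.
    case: x Ax => [i Ai||//]; first by exfalso; apply: noi; exists i.
    by move=> /MA.
  pose P n := `[< forall x, A x -> (x <= (M - n%:Z)%:E)%E >].
  have P0 : exists n, P n by exists 0; apply/asboolP => x /MA; rewrite subr0.
  have Pb n : P n -> (n <= `|M - i|)%N.
    move=> /asboolP /(_ _ Ai); rewrite lee_fin => h.
    have : (n%:Z <= M - i) by rewrite lerBrDr addrC -lerBrDr.
    by move=> h'; rewrite -lez_nat abszE (le_trans h') // ler_norm.
  have [n /asboolP Pn nmax] := ex_maxnP P0 Pb.
  exists (M - n%:Z)%:E; split=> [x /Pn //|z zA].
  case: z zA => [j jA||jA]; [|by rewrite leey|by have := jA _ Ai].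
  rewrite lee_fin leNgt; apply/negP => jlt.
  have Mj : 0 <= M - j.
    by rewrite subr_ge0 (le_trans (ltW jlt)) // gerBl.
  have : P `|M - j|%N.
    by apply/asboolP => x /jA; rewrite gez0_abs // opprB addrC subrK.
  move=> /nmax; rewrite -lez_nat gez0_abs // => h.
  by move: jlt; rewrite ltNge => /negP; apply; rewrite lerBlDr -lerBlDl.
split=> [h x Ax|h].
  by apply: le_trans h; exact: ge_supremum_Nmem.
case: (eqVneq A set0) => [->|A0]; first by rewrite supremum0 leNye.
rewrite /supremum (negbTE A0); case: xgetP => [z -> [_ zlb]|nsup].
  exact: zlb.
by case: supA => z /nsup.
Qed.

Section FilteredSpaces.

Definition prev_skel (T : Type) (F : nat -> set T) (i : nat) : set T :=
  if i is j.+1 then F j else set0.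

(* The skeleta are indexed by all of nat: [skel_mono] and [skel_top] force
   X_i = X for i >= n.  [skel_proper] reads X_{n-1} <> X, with X_{-1} empty. *)
Record filtered_space := FilteredSpace {
  fs_space :> topologicalType;
  fdim : nat;
  skel : nat -> set fs_space;
  fs_hausdorff : hausdorff_space fs_space;
  skel_closed : forall i, closed (skel i);
  skel_mono : forall i, skel i `<=` skel i.+1;
  skel_top : skel fdim = setT;
  skel_proper : prev_skel skel fdim <> setT }.

Arguments skel : clear implicits.

Variable X : filtered_space.
Local Notation n := (fdim X).

Definition layer (i : nat) : set X := skel X i `\` prev_skel (skel X) i.

Record stratum := Stratum {
  str_idx : 'I_n.+1;
  str_set :> set X;
  str_comp : exists2 x, layer str_idx x &
    str_set = connected_component (layer str_idx) x }.

Definition codim (S : stratum) : nat := n - str_idx S.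
Definition singular (S : stratum) : Prop := (0 < codim S)%N.

Record perversity := Perversity {
  perv :> stratum -> \bar int;
  perv_regular : forall S, ~ singular S -> perv S = 0%E }.

(* [adde] satisfies -oo + +oo = -oo. *)
Lemma perv_add_subproof (p q : perversity) S :
  ~ singular S -> (p S + q S)%E = 0%E.
Proof. by move=> nS; rewrite !perv_regular // adde0. Qed.

Definition perv_add (p q : perversity) : perversity :=
  Perversity (@perv_add_subproof p q).

End FilteredSpaces.

Arguments skel : clear implicits.

Section StandardSimplex.
Variable K : realType.

(* The standard simplex on N ordered vertices, of dimension N - 1. *)
Definition stdsimplex (N : nat) : set 'rV[K]_N :=
  [set x | (forall a, 0 <= x 0 a) /\ \sum_a x 0 a = 1].

Arguments stdsimplex N : clear implicits.

Variables (M N : nat) (phi : 'I_M -> 'I_N).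

Definition affine_ext (x : 'rV[K]_M) : 'rV[K]_N :=
  \row_b \sum_(a | phi a == b) x 0 a.

Lemma affine_ext_stdsimplex (x : stdsimplex M) :
  affine_ext (val x) \in stdsimplex N.
Proof.
have := valP x; rewrite !inE => -[x0 x1]; split=> [b|].
  by rewrite mxE sumr_ge0.
by rewrite -x1 (partition_big phi xpredT) //=; apply: eq_bigr => b _; rewrite mxE.
Qed.

Definition stdsimplex_map (x : stdsimplex M) : stdsimplex N :=
  SigSub (affine_ext_stdsimplex x).

Lemma affine_ext_continuous : continuous affine_ext.
Proof.
move=> x U [P nbhsP PU].
have xF : Filter (nbhs x) by exact: nbhs_filter.
pose g i j := [set y | P i j (affine_ext y i j)].
have gx i j : \near x, g i j x.
  have cont : (fun y : 'rV[K]_M => affine_ext y i j) @ x --> affine_ext x i j.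
    rewrite (_ : (fun _ => _) = fun y : 'rV[K]_M => \sum_(a | phi a == j) y 0 a).
      rewrite mxE; apply: (cvg_big add_continuous) => a _.
      exact: coord_continuous.
    by apply/funext => y; rewrite mxE.
  exact: cont (nbhsP i j).
have : nbhs x [set y | forall i j, g i j y].
  apply: (@filter_forall _ _ (fun i y => forall j, g i j y) _ xF) => i.
  by apply: (@filter_forall _ _ (g i) _ xF) => j; exact: gx.
by apply: filterS => y Py; apply: PU => i j; exact: Py.
Qed.

Lemma stdsimplex_map_continuous : continuous stdsimplex_map.
Proof.
apply: continuous_comp_initial => x.
apply: (@continuous_comp _ _ _ (set_val : stdsimplex M -> _) affine_ext x); first exact: initial_continuous.
exact: affine_ext_continuous.
Qed.

Lemma stdsimplex_map_eq0 (P : pred 'I_N) (x : stdsimplex M) :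
  (forall b, P b -> val (stdsimplex_map x) 0 b = 0) <->
  (forall a, P (phi a) -> val x 0 a = 0).
Proof.
have := valP x; rewrite inE => -[x0 _]; split=> [h a Pa|h b Pb].
  have /eqP := h _ Pa; rewrite mxE psumr_eq0 // => /allP /(_ a).
  by rewrite mem_index_enum eqxx => /(_ isT) /eqP.
by rewrite mxE big1 // => a /eqP ab; apply: h; rewrite ab.
Qed.

End StandardSimplex.

Arguments stdsimplex : clear implicits.

Section FilteredSimplices.
Variables (K : realType) (X : filtered_space).
Local Notation n := (fdim X).

(* The vertex a of the simplex lies in Delta_(fs_blk a); since fs_blk is
   monotone this is a join decomposition Delta_0 * ... * Delta_n compatible with
   the vertex order.  A point lies in Delta_0 * ... * Delta_i when its barycentric
   coordinates vanish on the vertices of the Delta_j with j > i.  The simplex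
   with fs_nv = 0 vertices is empty, hence never regular. *)
Record fsimplex := FSimplex {
  fs_nv : nat;
  fs_blk : {ffun 'I_fs_nv -> 'I_n.+1};
  fs_map : stdsimplex K fs_nv -> X;
  fs_blk_mono : forall a b : 'I_fs_nv, (a <= b)%N -> (fs_blk a <= fs_blk b)%N;
  fs_map_continuous : continuous fs_map;
  fs_map_filtered : forall (i : 'I_n.+1) (x : stdsimplex K fs_nv),
    skel X i (fs_map x) <-> (forall a, (i < fs_blk a)%N -> val x 0 a = 0) }.

HB.instance Definition _ := gen_eqMixin fsimplex.
HB.instance Definition _ := gen_choiceMixin fsimplex.

Definition fs_dim (s : fsimplex) : int := (fs_nv s)%:Z - 1.

Definition regular (s : fsimplex) : bool := [exists a, fs_blk s a == ord_max].

Definition rsimplex := {s : fsimplex | regular s}.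

Definition meets (s : fsimplex) (S : stratum X) : Prop :=
  (range (@fs_map s) `&` S) !=set0.

Section Face.
Variables (s : fsimplex) (G : {set 'I_(fs_nv s)}).

(* [enum_val] enumerates the vertices of G in increasing order. *)
Let phi (a : 'I_#|G|) : 'I_(fs_nv s) := enum_val a.

Lemma enum_val_ord_mono (a b : 'I_#|G|) : (a <= b)%N -> (phi a <= phi b)%N.
Proof.
have srt : sorted (fun i j : 'I_(fs_nv s) => (i <= j)%N) (enum G).
  rewrite /enum_mem -enumT; apply: sorted_filter; first by move=> ? ? ?; exact: leq_trans.
  by have := iota_sorted 0 (fs_nv s); rewrite -val_enum_ord sorted_map.
move=> ab; rewrite /phi !(enum_val_nth (enum_default a)).
apply: (sorted_leq_nth _ _ _ srt); rewrite ?inE -?cardE //.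
by move=> ? ? ?; exact: leq_trans.
Qed.

Definition face_map : stdsimplex K #|G| -> X :=
  @fs_map s \o stdsimplex_map phi.

Lemma face_blk_mono (a b : 'I_#|G|) : (a <= b)%N ->
  ([ffun i => fs_blk s (phi i)] a <= [ffun i => fs_blk s (phi i)] b)%N.
Proof. by rewrite !ffunE => /enum_val_ord_mono /fs_blk_mono. Qed.

Lemma face_map_continuous : continuous face_map.
Proof.
move=> x; apply: continuous_comp; first exact: stdsimplex_map_continuous.
exact: fs_map_continuous.
Qed.

Lemma face_map_filtered (i : 'I_n.+1) x : skel X i (face_map x) <->
  (forall a, (i < [ffun a => fs_blk s (phi a)] a)%N -> val x 0 a = 0).
Proof.
rewrite fs_map_filtered (stdsimplex_map_eq0 phi (fun b => i < fs_blk s b)%N).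
by split=> h a; have := h a; rewrite ffunE.
Qed.

(* The restriction of s to its face with vertex set G, with join decomposition
   G_i = the vertices of G in Delta_i. *)
Definition face : fsimplex :=
  FSimplex face_blk_mono face_map_continuous face_map_filtered.

End Face.

(* Delta_0 * ... * Delta_i, of dimension -oo if empty. *)
Definition join_dim (s : fsimplex) (i : nat) : \bar int :=
  let c := #|[set a | (fs_blk s a <= i)%N]%SET| in
  if c == 0 then -oo%E else (c%:Z - 1)%:E.

Definition simplex_allowable (q : perversity X) (s : fsimplex) : Prop :=
  forall S : stratum X, meets s S ->
    (join_dim s (n - codim S) <= (fs_dim s - (codim S)%:Z)%:E + q S)%E.

End FilteredSimplices.

Section Blowup.
Variables (n N : nat).

(* The pair (F, e) is the face F (e = false) or F * [v] (e = true) of a cone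
   cE on vertices of the ambient simplex; (set0, false) is not a face. *)
Definition cface : Type := {set 'I_N} * bool.

Definition cdeg (x : cface) : nat := (#|x.1| + x.2).-1.

Variable R : comPzRingType.

(* The coefficient of y in the boundary of x; the apex is the last vertex. *)
Definition incidence (x y : cface) : R :=
  (\sum_(a in x.1 | y == (x.1 :\ a, x.2)) (-1) ^+ #|[set b in x.1 | b < a]%N|)
  + (x.2 && (y == (x.1, false)))%:R * (-1) ^+ #|x.1|.

Variable blk : {ffun 'I_N -> 'I_n.+1}.

Definition block (i : 'I_n.+1) : {set 'I_N} := [set a | blk a == i].

(* The indices of the basis elements 1_(F, e): a face (F_i, e_i) of c Delta_i
   for each i < n, and a face F_n of Delta_n (e_n = false). *)
Definition is_cell (c : {ffun 'I_n.+1 -> cface}) : bool :=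
  [forall i, ((c i).1 \subset block i) && (c i != (finset.set0, false))]
  && ~~ (c ord_max).2.

Definition cell := {c : {ffun 'I_n.+1 -> cface} | is_cell c}.

(* N~^*(Delta), in the basis 1_(F, e). *)
Definition blowup := {ffun cell -> R^o}.
HB.instance Definition _ := GRing.Lmodule.on blowup.

Definition cell_deg (c : cell) : nat := (\sum_i cdeg (val c i))%N.

(* The coefficient of 1_d in the tensor product differential of 1_c. *)
Definition diff_coef (c d : cell) : R :=
  \sum_(i | [forall j, (j != i) ==> (val c j == val d j)])
    (-1) ^+ (\sum_(j : 'I_n.+1 | j < i) cdeg (val c j))%N
    * (- (-1) ^+ cdeg (val c i) * incidence (val d i) (val c i)).

Definition blowup_diff (w : blowup) : blowup :=
  [ffun d => \sum_c w c * diff_coef c d].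

Lemma blowup_diff_linear : linear blowup_diff.
Proof.
move=> a v w; apply/ffunP => d; rewrite !ffunE scaler_sumr -big_split /=.
apply: eq_bigr => c _; rewrite !ffunE mulrDl; congr (_ + _).
by rewrite -[RHS]/(a * _) mulrA.
Qed.

HB.instance Definition _ :=
  GRing.isLinear.Build R blowup blowup _ blowup_diff blowup_diff_linear.

Definition cell_norm (l : nat) (c : cell) : \bar int :=
  if (val c (inord (n - l))).2 then -oo%E
  else (\sum_(i : 'I_n.+1 | n - l < i) cdeg (val c i))%N%:Z%:E.

Definition blowup_norm (l : nat) (w : blowup) : \bar int :=
  \big[maxe/-oo%E]_(c | w c != 0) cell_norm l c.

(* F and G are compatible: the last vertex of F is the first vertex of G. *)
Definition compatible (F G : {set 'I_N}) : bool :=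
  [exists a, [&& a \in F, a \in G,
    [forall b in F, (b <= a)%N] & [forall b in G, (a <= b)%N]]].

(* 1_F cap [D], where [None] stands for 0. *)
Definition cap_simplex (D F : {set 'I_N}) : option {set 'I_N} :=
  [pick G | compatible F G && (F :|: G == D)%SET].

(* 1_(F, e) cap [cD]. *)
Definition cap_cone (D : {set 'I_N}) (x : cface) : option cface :=
  if x.2 then (if x.1 == D then Some (finset.set0, true) else None)
  else omap (fun G => (G, true)) (cap_simplex D x.1).

Definition cap_factor (c : cell) (i : 'I_n.+1) : option cface :=
  if i == ord_max then omap (fun G => (G, false)) (cap_simplex (block i) (val c i).1)
  else cap_cone (block i) (val c i).

Definition cap_tensor (c : cell) : option {ffun 'I_n.+1 -> cface} :=
  if [forall i, cap_factor c i : bool]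
  then Some [ffun i => odflt (finset.set0, true) (cap_factor c i)] else None.

Definition cap_sign (c : cell) : nat :=
  (\sum_(j : 'I_n.+1 | j < n)
    #|block j| * \sum_(i : 'I_n.+1 | j < i) cdeg (val c i))%N.

Definition mu (x : {ffun 'I_n.+1 -> cface}) : option {set 'I_N} :=
  let l := [arg min_(j < ord_max | ~~ (x j).2) (j : nat)] in
  let J := (\bigcup_(i : 'I_n.+1 | i <= l) (x i).1)%N%SET in
  if ((\sum_i cdeg (x i)).+1 == #|J|)%N then Some J else None.

End Blowup.

Section CellMap.
Variables (n M N : nat) (blk : {ffun 'I_N -> 'I_n.+1}) (phi : 'I_M -> 'I_N).

Let image_cell (c : {ffun 'I_n.+1 -> cface M}) : {ffun 'I_n.+1 -> cface N} :=
  [ffun i => (phi @: (c i).1, (c i).2)%SET].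

Lemma is_cell_image (c : cell [ffun a => blk (phi a)]) :
  is_cell blk (image_cell (val c)).
Proof.
have /andP[/forallP cP c_max] := valP c; apply/andP; split; last by rewrite ffunE.
apply/forallP => i; have /andP[c_sub c_neq] := cP i; rewrite ffunE /=.
apply/andP; split.
  apply/fintype.subsetP => _ /imsetP[a ac ->]; rewrite inE.
  by have := fintype.subsetP c_sub a ac; rewrite inE ffunE.
apply: contraNneq c_neq; rewrite [val c i]surjective_pairing xpair_eqE.
by case=> /eqP + ->; rewrite imset_eq0 => ->.
Qed.

(* The image under the simplicial map phi of a face of each factor. *)
Definition cell_map (c : cell [ffun a => blk (phi a)]) : cell blk :=
  exist (fun d => is_cell blk d) _ (is_cell_image c).

End CellMap.

Section Cochains.
Variables (K : realType) (R : comPzRingType) (X : filtered_space).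
Implicit Types (p : perversity X) (k : int) (S : stratum X).

Definition cochains :=
  families (fun s : rsimplex K X => blowup R (fs_blk (val s)) : lmodType R).

Implicit Types (w v : cochains).

Definition cochain_diff w : cochains := fun s => blowup_diff (w s).

Lemma cochain_diff_linear : linear cochain_diff.
Proof.
move=> a v w; apply: functional_extensionality_dep => s.
exact: (@linearP _ _ _ _ (@blowup_diff _ _ R _) a (v s) (w s)).
Qed.

HB.instance Definition _ :=
  GRing.isLinear.Build R cochains cochains _ cochain_diff cochain_diff_linear.

(* delta_l^* (w_s) = w_(s o delta_l) for each regular face operator delta_l,
   the inclusion of the face opposite to the vertex a. *)
Definition compatible_family w : Prop :=
  forall (s : rsimplex K X) (a : 'I_(fs_nv (val s)))
    (reg : regular (face [set~ a]%SET)) (c : cell (fs_blk (face [set~ a]%SET))),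
  w (exist (fun s : fsimplex K X => regular s) _ reg) c = w s (cell_map c).

Definition homogeneous k w : Prop :=
  forall s c, w s c != 0 -> (cell_deg c)%:Z = k.

Definition cochain_norm S w : \bar int :=
  supremum -oo%E
    [set blowup_norm (codim S) (w s) | s in [set s | meets (val s) S]].

Definition cochain_allowable p w : Prop :=
  forall S, singular S -> (cochain_norm S w <= p S)%E.

Definition blownup_cochains p k : {pred cochains} :=
  [pred w | `[< [/\ compatible_family w, homogeneous k w,
     cochain_allowable p w & cochain_allowable p (cochain_diff w)] >]].

Lemma cochain_allowableP p w : cochain_allowable p w <->
  forall S s c, singular S -> meets (val s) S -> w s c != 0 ->
    (cell_norm (codim S) c <= p S)%E.
Proof.
split=> [h S s c sgS sS wc|h S sgS].
  have /supremum_bareint_le /(_ (blowup_norm (codim S) (w s))) := h S sgS.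
  move=> /(_ (ex_intro2 _ _ s sS erefl)); apply: le_trans.
  by rewrite /blowup_norm (bigD1 c) //= le_max lexx.
apply/supremum_bareint_le => _ [s sS <-]; rewrite /blowup_norm.
by elim/big_ind: _ => [|x y xp yp|c wc]; [exact: leNye|rewrite ge_max xp|exact: h wc].
Qed.

Lemma cochain_allowable_linear p a v w :
  cochain_allowable p v -> cochain_allowable p w ->
  cochain_allowable p (a *: v + w).
Proof.
move=> /cochain_allowableP vp /cochain_allowableP wp.
apply/cochain_allowableP => S s c sgS sS h.
have [vc|] := eqVneq (v s c) 0; last exact: vp.
apply: (wp S s c sgS sS); apply: contra_neq h => wc.
by rewrite -[LHS]/((a *: v s + w s) c) !ffunE vc wc scaler0 addr0.
Qed.

Lemma cochain_allowable0 p : cochain_allowable p 0.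
Proof.
by apply/cochain_allowableP => S s c _ _; rewrite -[0]/(fam_zero _) /fam_zero ffunE eqxx.
Qed.

Lemma blownup_cochains_submod p k : submod_closed (blownup_cochains p k).
Proof.
split=> [|a v w].
  rewrite inE; split.
  - by move=> s a reg c; rewrite !ffunE.
  - by move=> s c; rewrite ffunE eqxx.
  - exact: cochain_allowable0.
  - by rewrite linear0; exact: cochain_allowable0.
rewrite !inE => -[vC vk vp dvp] [wC wk wp dwp]; split.
- by move=> s b reg c; rewrite !ffunE vC wC.
- move=> s c h; have [vc|] := eqVneq (v s c) 0; last exact: vk.
  apply: (wk s); apply: contra_neq h => wc.
  by rewrite -[LHS]/((a *: v s + w s) c) !ffunE vc wc scaler0 addr0.
- exact: cochain_allowable_linear.
- by rewrite linearP; exact: cochain_allowable_linear.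
Qed.

HB.instance Definition _ p k := GRing.isSubmodClosed.Build R cochains
  (blownup_cochains p k) (blownup_cochains_submod p k).

Definition cocycles p k : {pred cochains} :=
  [pred w | (w \in blownup_cochains p k) && (cochain_diff w == 0)].

Lemma cocyclesP p k v : reflect (v \in blownup_cochains p k /\ cochain_diff v = 0)
  (v \in cocycles p k).
Proof. by apply: (iffP andP) => -[? /eqP]. Qed.

Lemma cocycles_submod p k : submod_closed (cocycles p k).
Proof.
split=> [|a v w]; first by apply/cocyclesP; rewrite rpred0 linear0.
move=> /cocyclesP[vC dv] /cocyclesP[wC dw]; apply/cocyclesP.
by rewrite rpredD ?rpredZ // cochain_diff_linear dv dw scaler0 addr0.
Qed.

HB.instance Definition _ p k := GRing.isSubmodClosed.Build R cochains
  (cocycles p k) (cocycles_submod p k).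

Definition coboundaries p k : {pred cochains} :=
  [pred w | `[< exists2 v, v \in blownup_cochains p (k - 1)
                         & w = cochain_diff v >]].

Lemma coboundariesP p k v :
  reflect (exists2 w, w \in blownup_cochains p (k - 1) & v = cochain_diff w) (v \in coboundaries p k).
Proof. exact: asboolP. Qed.

Lemma coboundaries_submod p k : submod_closed (coboundaries p k).
Proof.
split=> [|a v w]; first by apply/coboundariesP; exists 0; rewrite ?rpred0 ?linear0.
move=> /coboundariesP[v' v'C ->] /coboundariesP[w' w'C ->]; apply/coboundariesP.
by exists (a *: v' + w'); rewrite ?linearP // rpredD ?rpredZ.
Qed.

HB.instance Definition _ p k := GRing.isSubmodClosed.Build R cochains
  (coboundaries p k) (coboundaries_submod p k).

Definition blownup_complex p k : lmodType R := submod (blownup_cochains p k).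
Definition cocycle_module p k : lmodType R := submod (cocycles p k).

Definition blownup_val p k (w : blownup_complex p k) : cochains := submod_val w.
Definition cocycle_val p k (w : cocycle_module p k) : cochains := submod_val w.

Definition blownup_cohomology p k : lmodType R :=
  subquot (cocycles p k) (coboundaries p k).

Definition cohomology_class p k (w : cocycle_module p k) :
  blownup_cohomology p k := subquot_class (coboundaries p k) w.

End Cochains.

Section Chains.
Variables (K : realType) (R : comPzRingType) (X : filtered_space).
Implicit Types (q : perversity X) (m : int).

(* Chains on all filtered simplices; the tame complex consists of the chains
   supported by regular simplices. *)
Definition chains := freemod R (fsimplex K X).

Implicit Types (x y : chains).

Definition supported (P : fsimplex K X -> Prop) x : Prop :=
  forall s, freemod_fun x s != 0 -> P s.

Definition tame_diff_simplex (s : fsimplex K X) : chains :=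
  \sum_(a : 'I_(fs_nv s) | regular (face [set~ a]%SET))
    (-1) ^+ a *: basis R (face [set~ a]%SET).

Definition tame_diff : chains -> chains := linext tame_diff_simplex.

Lemma tame_diff_linear : linear tame_diff.
Proof. exact: linext_linear. Qed.

HB.instance Definition _ :=
  GRing.isLinear.Build R chains chains _ tame_diff tame_diff_linear.

Definition tame_chains q m : {pred chains} :=
  [pred x | `[< supported
      (fun s => [/\ regular s, simplex_allowable q s & fs_dim s = m]) x /\
    supported (fun s => regular s /\ simplex_allowable q s) (tame_diff x) >]].

Lemma supported0 P : supported P 0.
Proof. by move=> s; rewrite eqxx. Qed.

Lemma supported_linear P a x y :
  supported P x -> supported P y -> supported P (a *: x + y).
Proof.
move=> xP yP s h; have [xs|] := eqVneq (freemod_fun x s) 0; last exact: xP.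
apply: yP; apply: contra_neq h => ys; rewrite /freemod_fun.
have -> : val (a *: x + y) = a *: val x + val y by rewrite linearP.
by rewrite -[LHS]/(a * freemod_fun x s + freemod_fun y s) xs ys mulr0 addr0.
Qed.

Lemma tame_chains_submod q m : submod_closed (tame_chains q m).
Proof.
split=> [|a x y].
  by rewrite inE linear0; split; exact: supported0.
rewrite !inE => -[xq dxq] [yq dyq]; rewrite tame_diff_linear.
by split; exact: supported_linear.
Qed.

HB.instance Definition _ q m := GRing.isSubmodClosed.Build R chains
  (tame_chains q m) (tame_chains_submod q m).

Definition cycles q m : {pred chains} :=
  [pred x | (x \in tame_chains q m) && (tame_diff x == 0)].

Lemma cyclesP q m x : reflect (x \in tame_chains q m /\ tame_diff x = 0)
  (x \in cycles q m).
Proof. by apply: (iffP andP) => -[? /eqP]. Qed.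

Lemma cycles_submod q m : submod_closed (cycles q m).
Proof.
split=> [|a x y]; first by apply/cyclesP; rewrite rpred0 linear0.
move=> /cyclesP[xC dx] /cyclesP[yC dy]; apply/cyclesP.
by rewrite rpredD ?rpredZ // tame_diff_linear dx dy scaler0 addr0.
Qed.

HB.instance Definition _ q m := GRing.isSubmodClosed.Build R chains
  (cycles q m) (cycles_submod q m).

Definition boundaries q m : {pred chains} :=
  [pred x | `[< exists2 y, y \in tame_chains q (m + 1) & x = tame_diff y >]].

Lemma boundariesP q m x :
  reflect (exists2 y, y \in tame_chains q (m + 1) & x = tame_diff y) (x \in boundaries q m).
Proof. exact: asboolP. Qed.

Lemma boundaries_submod q m : submod_closed (boundaries q m).
Proof.
split=> [|a x y]; first by apply/boundariesP; exists 0; rewrite ?rpred0 ?linear0.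
move=> /boundariesP[x' x'C ->] /boundariesP[y' y'C ->]; apply/boundariesP.
by exists (a *: x' + y'); rewrite ?linearP // rpredD ?rpredZ.
Qed.

HB.instance Definition _ q m := GRing.isSubmodClosed.Build R chains
  (boundaries q m) (boundaries_submod q m).

Definition tame_complex q m : lmodType R := submod (tame_chains q m).
Definition cycle_module q m : lmodType R := submod (cycles q m).

Definition tame_val q m (x : tame_complex q m) : chains := submod_val x.
Definition cycle_val q m (x : cycle_module q m) : chains := submod_val x.

Definition tame_homology q m : lmodType R :=
  subquot (cycles q m) (boundaries q m).

Definition homology_class q m (x : cycle_module q m) : tame_homology q m :=
  subquot_class (boundaries q m) x.

End Chains.

Section CapProduct.
Variables (K : realType) (R : comPzRingType) (X : filtered_space).

(* s_*(1_c cap Delta~) *)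
Definition cap_cell (s : rsimplex K X) (c : cell (fs_blk (val s))) :
    chains K R X :=
  if obind (@mu _ _) (cap_tensor c) is Some G
  then (-1) ^+ cap_sign c *: basis R (face G) else 0.

Definition cap_rsimplex (w : cochains K R X) (s : rsimplex K X) : chains K R X :=
  \sum_c w s c *: cap_cell c.

Definition cap (w : cochains K R X) (x : chains K R X) : chains K R X :=
  \sum_(s \in [set: rsimplex K X]) freemod_fun x (val s) *: cap_rsimplex w s.

End CapProduct.

Arguments blownup_cochains K R {X} p k.
Arguments cocycles K R {X} p k.
Arguments coboundaries K R {X} p k.
Arguments blownup_complex K R {X} p k.
Arguments cocycle_module K R {X} p k.
Arguments blownup_cohomology K R {X} p k.
Arguments tame_chains K R {X} q m.
Arguments cycles K R {X} q m.
Arguments boundaries K R {X} q m.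
Arguments tame_complex K R {X} q m.
Arguments cycle_module K R {X} q m.
Arguments tame_homology K R {X} q m.

(* Main.v *)
Require Import Defs.
From mathcomp Require Import all_boot all_order all_algebra zify ring finmap.
From mathcomp Require Import all_classical all_reals all_analysis.

Set Implicit Arguments.
Unset Strict Implicit.
Unset Printing Implicit Defensive.

Import Order.TTheory GRing.Theory Num.Theory.
Local Open Scope ring_scope.

(** Everything follows from the Leibniz rule
      d (w cap x) = (dw) cap x + (-1)^|w| w cap (dx)
    together with a bound on the position of the face w cap s inside s.

    _Shape of the cap product._  Capping [1_(F, e)] with the cone on a simplex
    [D] gives zero unless [F] is an initial segment of [D] (when [e = 0]) or all
    of [D] (when [e = 1]).  The set [gap D (F, e)] of the vertices that [F] skips
    measures the failure, and when it is empty the answer is the face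
    [tail D (F, e)]: the final segment that starts at the last vertex of [F], or
    nothing when [e = 1].  Every coned factor of a capped tensor keeps its apex,
    so the map [mu] always takes the join over all factors, and its degree
    condition always holds ([cap_tensorE]): [1_c cap Delta] is, up to sign, the
    face spanned by the union of the tails.

    _Leibniz rule._  Both sides are sums over the join factors in which a single
    factor is modified, so the rule reduces to an identity in one cone
    ([factor_leibniz]).  There, if [F] skips two vertices or more all terms
    vanish; if it skips exactly one, adding that vertex to [F] (the differential
    of the cochain) and deleting it from [D] (the boundary of the simplex) cancel
    each other; if it skips none, one has the usual formula for a front face and
    a back face.  The face of a cone opposite to its apex would make [mu] stop before the
    last factor; it has no term because the tame differential only keeps regular
    faces, and for the same reason a face without vertex in the last factor counts
    as zero.  The signs of the tensor product are then compared in [cell_leibniz],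
    and compatibility of the family [w] identifies the cap product on a face of
    [s] with the part of the sum over the cells of [s] that avoid the deleted
    vertex ([cap_rsimplex_face]).

    _Allowability._  If the face [w cap s] meets a stratum [S] of index [i], it
    has a vertex in the factor [i]; hence the tail of this factor is non-empty
    and its [e_i] is [0], which is the case in which the perverse degree of the
    cell along [S] is the total degree of the factors [j > i].  Since capping
    lowers the number of vertices of each factor by exactly its degree
    ([card_tail]), passing from [s] to the face costs this number in the
    inequality of allowability, and the perversity of [w] pays for it
    ([cap_face_allowable]).

    The Leibniz rule shows that [w cap x] has an allowable differential, and that
    the cap product of cocycles and cycles passes to homology. *)

(** * The cap product in one cone *)

Section ConeFactor.
Import fintype boot.finset.
Variable N : nat.
Implicit Types (D F G S : {set 'I_N}) (x y : cface N) (a b : 'I_N).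

Definition rank S a : nat := #|[set b in S | (b < a)%N]|.

Definition below x a : bool := x.2 || [exists f in x.1, (a < f)%N].

(** The vertices of [D] that prevent [1_x] from being capped with the cone on [D]:
    all those missing from [x] if [x] contains the apex, and those missing before
    the last vertex of [x] otherwise. *)
Definition gap D x : {set 'I_N} := [set b in D :\: x.1 | below x b].

(** The value, without its apex, of [1_x cap cD] when [gap D x] is empty. *)
Definition tail D x : {set 'I_N} := [set b in D | ~~ x.2 && [forall f in x.1, (f <= b)%N]].

Lemma tail_sub D x : tail D x \subset D.
Proof. by apply/subsetP => b; rewrite inE => /andP[]. Qed.

Lemma tail_apex D F : tail D (F, true) = set0.
Proof. by apply/setP => b; rewrite !inE andbF. Qed.

Lemma gapD1 D x a : gap (D :\ a) x = gap D x :\ a.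
Proof. by apply/setP => b; rewrite !inE; case: (b == a); rewrite //= !andbF. Qed.

Lemma tailD1 D x a : tail (D :\ a) x = tail D x :\ a.
Proof. by apply/setP => b; rewrite !inE -andbA. Qed.

Lemma below_mono x a b : (a <= b)%N -> below x b -> below x a.
Proof.
move=> ab; rewrite /below => /orP[->//|/existsP[f /andP[fx bf]]].
by apply/orP; right; apply/existsP; exists f; rewrite fx (leq_ltn_trans ab).
Qed.

Lemma below_add x a b : below x b -> below (a |: x.1, x.2) b.
Proof.
rewrite /below => /orP[->//|/existsP[f /andP[fx bf]]].
by apply/orP; right; apply/existsP; exists f; rewrite bf !inE fx orbT.
Qed.

Lemma below_addE x a b : below x a -> below (a |: x.1, x.2) b = below x b.
Proof.
move=> ax; apply/idP/idP => [|/below_add]; last by apply.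
rewrite {1}/below /= => /orP[x2|/existsP[f /andP[]]]; first by rewrite /below x2.
rewrite !inE => /orP[/eqP->|fx] bf; first exact: below_mono (ltnW bf) ax.
by apply/orP; right; apply/existsP; exists f; rewrite fx.
Qed.

(** Filling a gap, or deleting the missing vertex from the ambient simplex, has
    the same effect on the remaining gaps and on the tail. *)
Lemma gap_add D x a : below x a -> gap D (a |: x.1, x.2) = gap (D :\ a) x.
Proof.
move=> ax; apply/setP => b; rewrite !inE below_addE //=.
by rewrite negb_or; case: (b == a); rewrite //= andbF.
Qed.

Lemma tail_add D x a : x.2 || (x.1 != set0) ->
  below x a -> tail D (a |: x.1, x.2) = tail (D :\ a) x.
Proof.
move=> x0 ax; apply/setP => b; rewrite !inE /=.
case x2: x.2; rewrite ?andbF //=; move: ax; rewrite /below x2 /=.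
move=> /existsP[g /andP[gx ag]].
case: (altP (b =P a)) => [->|ba] /=.
  apply: contraTF gx => /andP[_ /forallP /(_ g)]; rewrite !inE.
  by case: (g \in x.1) => //; rewrite orbT /= leqNgt ag.
congr (_ && _); apply/forallP/forallP => h f.
  by apply/implyP => fx; have := h f; rewrite !inE fx orbT.
apply/implyP; rewrite !inE => /orP[/eqP->|fx]; last by have := h f; rewrite fx.
by apply: ltnW; have := h g; rewrite gx /=; apply: leq_trans.
Qed.

Lemma gap_add_sub D x a : a \notin gap D x -> gap D x \subset gap D (a |: x.1, x.2).
Proof.
move=> ax; apply/subsetP => b bx; move: (bx); rewrite !inE => /andP[/andP[bx1 bD]] bb.
rewrite negb_or bx1 bD below_add // !andbT.
by apply: contraNneq ax => <-.
Qed.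

Lemma gap_cone_sub D x : gap D x \subset gap D (x.1, true).
Proof. by apply/subsetP => b; rewrite !inE => /andP[-> _]. Qed.

Lemma gap_neq0 D D' x x' : gap D x \subset gap D' x' -> gap D x != set0 ->
  (gap D' x' == set0) = false.
Proof.
by move=> sub; apply: contraNF => /eqP e; rewrite e subset0 in sub.
Qed.

(** If [a] is the only gap, every vertex of [D] before [a] belongs to [x], so that
    the two ways to close the gap come with the same sign. *)
Lemma rank_gap D x a : x.1 \subset D -> a \in gap D x -> gap D x :\ a = set0 ->
  rank D a = rank (a |: x.1) a.
Proof.
move=> xD ag ge; apply: eq_card => b; rewrite !inE.
case: (ltnP b a) => ba; rewrite ?andbF // !andbT (_ : (b == a) = false) /=; last first.
  by apply/eqP => e; move: ba; rewrite e ltnn.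
apply/idP/idP => [bD|]; last exact: (subsetP xD).
apply: contraT => bx; have : b \in gap D x :\ a.
  rewrite !inE bx bD /=; apply/andP; split.
    by apply/eqP => e; move: ba; rewrite e ltnn.
  by move: ag; rewrite inE => /andP[_]; apply: below_mono; rewrite ltnW.
by rewrite ge inE.
Qed.

Lemma rankU1 S a : rank (a |: S) a = rank S a.
Proof.
by apply: eq_card => b; rewrite !inE; case: (altP (b =P a)) => // ->; rewrite ltnn !andbF.
Qed.

Lemma gap0_tail D F : F \subset D -> F != set0 -> gap D (F, false) = set0 ->
  exists k, [/\ k \in F, forall f, f \in F -> (f <= k)%N,
    forall a, a \in D :\: F -> forall f, f \in F -> (f < a)%N &
    tail D (F, false) = k |: (D :\: F)].
Proof.
move=> FD /set0Pn[f0 f0F] ge.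
have [k kF kmax] : exists2 k, k \in F & forall f, f \in F -> (f <= k)%N.
  by case: (arg_maxnP (P := mem F) (fun i : 'I_N => i : nat) f0F) => k kF km; exists k.
have big a : a \in D :\: F -> forall f, f \in F -> (f < a)%N.
  move=> aDF f fF; rewrite ltnNge; apply/negP => af.
  suff : a \in gap D (F, false) by rewrite ge inE.
  rewrite inE aDF /below /=; apply/existsP; exists f; rewrite fF ltn_neqAle af andbT.
  by apply: contraTneq aDF => e; rewrite !inE (val_inj e) fF.
have kD := subsetP FD _ kF.
exists k; split=> //.
apply/setP => b; rewrite !inE /=; apply/andP/idP.
  move=> [bD /forallP /(_ k)]; rewrite kF /= bD andbT => kb.
  case: (boolP (b \in F)) => bF; rewrite ?orbT ?orbF //.
  by apply/eqP/val_inj/eqP; rewrite eqn_leq kb kmax.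
move=> /orP[/eqP->|/andP[bF bD]]; split=> //; apply/forallP => f; apply/implyP => fF.
  exact: kmax.
by apply/ltnW/big; rewrite // !inE bF.
Qed.

(** Capping with a cochain of degree [r] lowers the dimension by [r]; here the
    dimension of a cone on [D] is [#|D|]. *)
Lemma card_tail D x : x.1 \subset D -> x != (set0, false) -> gap D x = set0 ->
  (#|tail D x| + cdeg x)%N = #|D|.
Proof.
case: x => F [] /= FD Fn0 ge; rewrite /cdeg /=.
  rewrite tail_apex cards0 addn1 /=; apply: eq_card => b; apply/idP/idP.
    exact: (subsetP FD).
  move=> bD; apply: contraT => bF; suff : b \in gap D (F, true) by rewrite ge inE.
  by rewrite !inE bF bD.
have F0 : F != set0 by move: Fn0; rewrite xpair_eqE andbT.
have [k [kF _ _ ->]] := gap0_tail FD F0 ge.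
rewrite cardsU1 !inE kF /= addn0 cardsD (setIidPr FD).
by rewrite addnAC add1n prednK ?card_gt0 // subnKC // subset_leq_card.
Qed.

End ConeFactor.

Section FactorLeibniz.
Import fintype boot.finset.
Variables (N : nat) (R : comPzRingType) (V : lmodType R) (B : {set 'I_N} -> V).
Implicit Types (D F G S : {set 'I_N}) (x y : cface N) (a b : 'I_N).

Definition cap_value D x : V := if gap D x == set0 then B (tail D x) else 0.

Definition simplex_boundary S : V := \sum_(a in S) (-1) ^+ rank S a *: B (S :\ a).

Lemma sum_incidence D x (f : cface N -> V) : x.1 \subset D ->
  \sum_(y : cface N | y.1 \subset D) incidence R y x *: f y =
  \sum_(a in D :\: x.1) (-1) ^+ rank (a |: x.1) a *: f (a |: x.1, x.2)
  + (if x.2 then 0 else (-1) ^+ #|x.1| *: f (x.1, true)).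
Proof.
move=> xD; rewrite /incidence.
under eq_bigr => y _ do rewrite scalerDl scaler_suml.
rewrite big_split /=; congr (_ + _).
  rewrite (exchange_big_dep (fun a => a \in D :\: x.1)) /=; last first.
    move=> y a yD /andP[ay /eqP->] /=; rewrite !inE eqxx /=; exact: (subsetP yD).
  apply: eq_bigr => a; rewrite inE => /andP[ax aD].
  rewrite (big_pred1 (a |: x.1, x.2)) => [//|[F e]] /=.
  rewrite [x]surjective_pairing /= !xpair_eqE /=; apply/idP/idP.
    by move=> /and3P[_ aF /andP[/eqP-> /eqP->]]; rewrite setD1K ?eqxx.
  move=> /andP[/eqP-> /eqP->]; rewrite setU11 eqxx setU1K // eqxx /= andbT.
  by rewrite subUset sub1set aD.
case: x xD => F [] /= FD.
  rewrite big1 // => -[F' e] _ /=; rewrite xpair_eqE !andbF mul0r scale0r //.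
rewrite (bigD1 (F, true)) //= eqxx mul1r big1 ?addr0 // => -[F' e] /= /andP[_].
rewrite !xpair_eqE eqxx andbT; case: e => /=; last by rewrite mul0r scale0r.
by rewrite andbT eq_sym => /negbTE->; rewrite mul0r scale0r.
Qed.

Lemma cap_value_fill D x a : x.1 \subset D -> x.2 || (x.1 != set0) -> a \in gap D x ->
  (-1) ^+ rank D a *: cap_value (D :\ a) x =
  (-1) ^+ rank (a |: x.1) a *: cap_value D (a |: x.1, x.2).
Proof.
move=> xD x0 ag; have ab : below x a by move: ag; rewrite inE => /andP[].
rewrite /cap_value gap_add // tail_add // gapD1; case: eqP => [ge|]; last by rewrite !scaler0.
by rewrite (rank_gap xD ag ge).
Qed.

(** The value of [B] on the empty set stands for the apex alone.  The face of the
    cone opposite to the apex has no term in this identity. *)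
Lemma factor_leibniz D x : x.1 \subset D -> x != (set0, false) ->
  (if gap D x == set0 then simplex_boundary (tail D x) else 0) =
  (-1) ^+ cdeg x *: (\sum_(a in D :\: x.1) (-1) ^+ rank D a *: cap_value (D :\ a) x
     - \sum_(y : cface N | y.1 \subset D) incidence R y x *: cap_value D y).
Proof.
move=> xD xn0; have x0 : x.2 || (x.1 != set0).
  by move: xn0; case: x {xD} => F [] //=; rewrite xpair_eqE eqxx andbT.
rewrite sum_incidence //.
have [ge|gn] := eqVneq (gap D x) set0; last first.
  (* The terms of a gap cancel in pairs; a vertex after the last vertex of x
     cannot close the existing gap, and neither can the apex. *)
  have -> : cap_value D (x.1, true) = 0.
    by rewrite /cap_value (gap_neq0 (gap_cone_sub D x) gn).
  rewrite scaler0 if_same addr0.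
  rewrite -sumrB big1 ?scaler0 // => a aD.
  case ag: (a \in gap D x); first by rewrite cap_value_fill // subrr.
  rewrite /cap_value (gap_neq0 _ gn) ?(gap_neq0 _ gn) ?gap_add_sub ?ag //.
    by rewrite !scaler0 subrr.
  by rewrite gapD1 subsetD1 subxx ag.
case: x xD xn0 x0 ge => F [] /= FD Fn0 F0 ge.
  have DF : D :\: F = set0 by rewrite -ge; apply/setP => b; rewrite !inE andbT.
  by rewrite DF !big_set0 tail_apex /simplex_boundary big_set0 addr0 subrr scaler0.
have [k [kF kmax big tE]] := gap0_tail FD F0 ge.
have kDF : k \notin D :\: F by rewrite !inE kF.
have rankF a : a \in D :\: F -> rank (a |: F) a = #|F|.
  move=> aDF; rewrite rankU1; apply: eq_card => b; rewrite !inE.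
  by case: (boolP (b \in F)) => //= bF; rewrite big.
have rankk : rank (k |: (D :\: F)) k = 0%N.
  apply/eqP; rewrite cards_eq0; apply/eqP/setP => b; rewrite [RHS]inE.
  rewrite inE in_setU1; case: (altP (b =P k)) => [->|_] /=; first by rewrite ltnn.
  by apply/negP => /andP[/big /(_ _ kF) kb]; rewrite ltnNge ltnW.
have cF : (#|F|.-1.+1 = #|F|)%N by rewrite prednK // card_gt0.
have rankD a : a \in D :\: F -> rank D a = (#|F|.-1 + rank (k |: (D :\: F)) a)%N.
  move=> aDF; apply: succn_inj; rewrite -addSn cF /rank.
  have := cardsUI F [set b in k |: (D :\: F) | (b < a)%N].
  rewrite (_ : _ :&: _ = [set k]); last first.
    apply/setP => b; rewrite !inE; case: (altP (b =P k)) => [->|_] /=.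
      by rewrite kF big.
    by case: (b \in F).
  rewrite cards1 addn1 => <-; congr (_.+1); apply: eq_card => b; rewrite !inE.
  case: (boolP (b \in F)) => bF /=; first by rewrite big // (subsetP FD).
  by rewrite (_ : (b == k) = false) //; apply: contraNF bF => /eqP->.
rewrite tE /simplex_boundary big_setU1 //= rankk expr0 scale1r.
rewrite setU1K // scalerBr addrC; congr (_ + _).
  rewrite scaler_sumr; apply: eq_bigr => a aDF.
  rewrite /cap_value gapD1 ge set0D eqxx tailD1 tE scalerA -exprD /cdeg /= addn0.
  by rewrite rankD // addnA exprD addnn -mul2n exprM sqrrN !expr1n mul1r.
(* The cochain differential contributes only the first vertex after F, or the
   apex if F already exhausts D; both give the face of the tail without k. *)
have cT : cap_value D (F, true) = if D :\: F == set0 then B set0 else 0.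
  rewrite /cap_value tail_apex; congr (if _ == _ then _ else _).
  by apply/setP => b; rewrite !inE /= ?andbT.
rewrite cT /cdeg /= addn0.
transitivity (- ((-1) ^+ #|F|.-1 *: ((-1) ^+ #|F| *: B (D :\: F)))).
  rewrite scalerA -exprD -{2}cF addnS addnn -mul2n exprS exprM sqrrN !expr1n mulr1.
  by rewrite scaleN1r opprK.
congr (- (_ *: _)); have [DF|/set0Pn[a0 a0DF]] := eqVneq (D :\: F) set0.
  by rewrite DF big_set0 add0r.
rewrite scaler0 addr0.
have [a aDF amin] : exists2 a, a \in D :\: F & forall b, b \in D :\: F -> (a <= b)%N.
  case: (arg_minnP (P := mem (D :\: F)) (fun i : 'I_N => i : nat) a0DF) => a aF am.
  by exists a.
rewrite (bigD1 a) //= rankF // [X in _ + X]big1 ?addr0 => [|b /andP[bDF ba]]; last first.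
  rewrite /cap_value ifN ?scaler0 //; apply/set0Pn; exists a.
  move: aDF; rewrite !inE negb_or => /andP[-> aD]; rewrite aD eq_sym ba /=.
  rewrite /below /=; apply/existsP; exists b; rewrite setU11 ltn_neqAle amin // andbT.
  by apply: contraNneq ba => e; apply/eqP/val_inj.
congr (_ *: _); rewrite /cap_value ifT.
  congr B; apply/setP => b; rewrite !inE /=; apply/idP/andP.
    move=> /andP[bF bD]; split=> //; apply/forallP => f; apply/implyP; rewrite !inE.
    by case/orP=> [/eqP->|fF]; [rewrite amin // !inE bF|apply/ltnW/big; rewrite // !inE bF].
  move=> [bD /forallP h]; rewrite bD andbT; apply/negP => bF.
  by have := h a; rewrite setU11 /= leqNgt big.
apply/eqP/setP => b; rewrite [RHS]inE; apply/negbTE; rewrite !inE negb_or /below /=.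
apply/negP => /andP[/andP[/andP[ba bF] bD] /existsP[f]]; rewrite !inE.
have bDF : b \in D :\: F by rewrite !inE bF.
move=> /andP[/orP[/eqP->|fF]]; first by rewrite ltnNge amin.
by rewrite ltnNge ltnW ?big.
Qed.

End FactorLeibniz.

(** * Tensor products of cones *)

Section Tensor.
Import fintype boot.finset.
Variables (n N : nat).
Implicit Types (D : 'I_n.+1 -> {set 'I_N}) (c d : {ffun 'I_n.+1 -> cface N}).
Implicit Types (i j : 'I_n.+1).

(** The factors [D] vary, because the faces of a simplex are treated as the same
    data with one vertex removed. *)
Definition all_capped D c : bool := [forall i, gap (D i) (c i) == set0].
Definition join_tail D c : {set 'I_N} := \bigcup_i tail (D i) (c i).

Definition others_capped i D c : bool := [forall (j | j != i), gap (D j) (c j) == set0].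
Definition join_others i D c : {set 'I_N} := \bigcup_(j | j != i) tail (D j) (c j).

(** The exponent of the Koszul sign of the cap product with the tensor product of
    the cones on the [D j], where [n - 1] is the last coned factor. *)
Definition tensor_sign D c : nat :=
  (\sum_(j : 'I_n.+1 | j < n) #|D j| * \sum_(i : 'I_n.+1 | j < i) cdeg (c i))%N.

Lemma all_cappedE i D c :
  all_capped D c = others_capped i D c && (gap (D i) (c i) == set0).
Proof.
apply/forallP/andP => [h|[/forallP h gi] j].
  by split=> //; apply/forallP => j; apply/implyP => _.
by have [->//|ji] := eqVneq j i; have := h j; rewrite ji.
Qed.

Lemma join_tailE i D c :
  join_tail D c = tail (D i) (c i) :|: join_others i D c.
Proof. by rewrite /join_tail (bigD1 i). Qed.

Section Congruence.
Variables (i : 'I_n.+1) (D D' : 'I_n.+1 -> {set 'I_N}) (c c' : {ffun 'I_n.+1 -> cface N}).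
Hypotheses (DD' : forall j, j != i -> D j = D' j) (cc' : forall j, j != i -> c j = c' j).

Lemma eq_others_capped : others_capped i D c = others_capped i D' c'.
Proof.
apply: eq_forallb => j; case: (altP (j =P i)) => //= ji.
by rewrite DD' // cc'.
Qed.

Lemma eq_join_others : join_others i D c = join_others i D' c'.
Proof. by apply: eq_bigr => j ji; rewrite DD' // cc'. Qed.

End Congruence.

Definition update c i (y : cface N) := [ffun j => if j == i then y else c j].

Lemma update_same c i y : update c i y i = y. Proof. by rewrite ffunE eqxx. Qed.
Lemma update_other c i y j : j != i -> update c i y j = c j.
Proof. by rewrite ffunE => /negbTE->. Qed.

End Tensor.

Section Blocks.
Import fintype boot.finset.
Variables (n N : nat) (blk : {ffun 'I_N -> 'I_n.+1}).
Implicit Types (T : 'I_n.+1 -> {set 'I_N}) (i j : 'I_n.+1).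

Lemma card_blocks (S : {set 'I_N}) : #|S| = (\sum_j #|S :&: block blk j|)%N.
Proof.
rewrite -sum1_card (partition_big blk predT) //=; apply: eq_bigr => j _.
by rewrite -sum1_card; apply: eq_bigl => b; rewrite !inE.
Qed.

Section Join.
Variable T : 'I_n.+1 -> {set 'I_N}.
Hypothesis TB : forall j, T j \subset block blk j.

Lemma mem_join b : (b \in \bigcup_j T j) = (b \in T (blk b)).
Proof.
apply/bigcupP/idP => [[j _ bj]|]; last by exists (blk b).
by have := subsetP (TB j) b bj; rewrite inE => /eqP->.
Qed.

Lemma mem_blk i b : b \in T i -> blk b = i.
Proof. by move=> /(subsetP (TB i)); rewrite inE => /eqP. Qed.

Lemma join_block i : (\bigcup_j T j) :&: block blk i = T i.
Proof.
apply/setP => b; rewrite inE mem_join [b \in block _ _]inE.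
apply/andP/idP => [[h /eqP<-]//|bi]; have e := mem_blk bi; by rewrite e bi eqxx.
Qed.

Lemma card_join : #|\bigcup_j T j| = (\sum_j #|T j|)%N.
Proof. by rewrite card_blocks; apply: eq_bigr => j _; rewrite join_block. Qed.

Lemma sum_join (V : zmodType) (f : 'I_N -> V) :
  \sum_(b in \bigcup_j T j) f b = \sum_j \sum_(b in T j) f b.
Proof.
rewrite (partition_big blk predT) //=; apply: eq_bigr => j _; apply: eq_bigl => b.
rewrite mem_join; apply/andP/idP => [[h /eqP<-]//|bj]; have e := mem_blk bj.
by rewrite e bj eqxx.
Qed.

Hypothesis mono : forall a b : 'I_N, (a <= b)%N -> (blk a <= blk b)%N.

Lemma lt_blk (a b : 'I_N) : (blk a < blk b)%N -> (a < b)%N.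
Proof. by rewrite !ltnNge; apply: contra => /mono. Qed.

(** Since the blocks follow each other, the position of a vertex in a join is its
    position in its own factor shifted by the size of the previous factors. *)
Lemma rank_join i b : b \in block blk i ->
  rank (\bigcup_j T j) b = (\sum_(j : 'I_n.+1 | j < i) #|T j| + rank (T i) b)%N.
Proof.
rewrite inE => /eqP bi; rewrite /rank card_blocks (bigID (fun j : 'I_n.+1 => (j < i)%N)) /=.
congr addn.
  apply: eq_bigr => j ji; apply: eq_card => a; rewrite !inE mem_join.
  apply/andP/idP => [[/andP[h _] /eqP<-]//|aj]; have e := mem_blk aj.
  by rewrite e aj eqxx lt_blk // e bi.
rewrite (bigD1 i) ?ltnn //= [X in (_ + X)%N]big1 ?addn0 => [|j]; last first.
  rewrite -leqNgt => /andP[ij ji]; apply/eqP; rewrite cards_eq0; apply/eqP/setP => a.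
  rewrite !inE; apply/negP => /andP[/andP[_ ab] /eqP aj].
  have := mono (ltnW ab); rewrite aj bi => ji'; case/eqP: ji; apply/val_inj/eqP.
  by rewrite eqn_leq ij ji'.
apply: eq_card => a; rewrite !inE mem_join.
apply/andP/andP => [[/andP[h ab] /eqP<-]//|[ai ab]]; have e := mem_blk ai.
by rewrite e ai ab eqxx.
Qed.

End Join.

Lemma bigcup_blocks : \bigcup_j block blk j = [set: 'I_N].
Proof. by apply/setP => b; rewrite [RHS]inE; apply/bigcupP; exists (blk b); rewrite ?inE. Qed.

Lemma rank_setT (b : 'I_N) : rank [set: 'I_N] b = b.
Proof.
rewrite /rank -sum1_card (eq_bigl (fun a : 'I_N => (a < b)%N)) => [|a]; last by rewrite !inE.
by rewrite -(big_ord_widen N (fun=> 1%N) (ltnW (ltn_ord b))) sum_nat_const card_ord muln1.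
Qed.

End Blocks.

(** * The Leibniz rule for a single cell *)

Section TensorLeibniz.
Import fintype boot.finset.
Variables (n N : nat) (blk : {ffun 'I_N -> 'I_n.+1}) (R : comPzRingType) (V : lmodType R).
Variable E : {set 'I_N} -> V.
Implicit Types (D : 'I_n.+1 -> {set 'I_N}) (c d : {ffun 'I_n.+1 -> cface N}).
Implicit Types (i j : 'I_n.+1).

Definition tensor_value D c : V := if all_capped D c then E (join_tail D c) else 0.

Lemma tensor_valueE i D c : tensor_value D c =
  if others_capped i D c
  then cap_value (fun S => E (S :|: join_others i D c)) (D i) (c i) else 0.
Proof.
rewrite /tensor_value (all_cappedE i) (join_tailE i) /cap_value.
by case: others_capped; case: eqP.
Qed.

Definition block_minus (a : 'I_N) i : {set 'I_N} := block blk i :\ a.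

Lemma block_minus_other i j a : a \in block blk i -> j != i -> block_minus a j = block blk j.
Proof.
move=> ai ji; apply/setDidPl; rewrite disjoint_sym disjoints1.
by apply: contraNN ji; move: ai; rewrite !inE => /eqP->; rewrite eq_sym.
Qed.

Hypothesis mono : forall a b : 'I_N, (a <= b)%N -> (blk a <= blk b)%N.
(* Only faces with a vertex in the last factor are regular. *)
Hypothesis E0 : forall S, S :&: block blk ord_max = set0 -> E S = 0.

Variable c : {ffun 'I_n.+1 -> cface N}.
Hypothesis c_cell : is_cell blk c.

Lemma cell_sub i : (c i).1 \subset block blk i.
Proof. by have /andP[/forallP/(_ i)/andP[]] := c_cell. Qed.

Lemma cell_neq0 i : c i != (set0, false).
Proof. by have /andP[/forallP/(_ i)/andP[]] := c_cell. Qed.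

Local Notation B := (block blk).
Local Notation others i := (others_capped i B c).
Local Notation E_ i := (fun S => E (S :|: join_others i B c)).
Local Notation degree := (\sum_i cdeg (c i))%N.
Local Notation cells_before i := (\sum_(j : 'I_n.+1 | (j < i)%N) cdeg (c j))%N.
Local Notation cells_after i := (\sum_(j : 'I_n.+1 | (i < j)%N) cdeg (c j))%N.
Local Notation blocks_before i := (\sum_(j : 'I_n.+1 | (j < i)%N) #|B j|)%N.

Lemma cell_last : exists2 F, c ord_max = (F, false) & F != set0.
Proof.
have /andP[_] := c_cell; have := cell_neq0 ord_max.
by case: (c ord_max) => F [] //= Fn0 _; exists F; rewrite // xpair_eqE andbT in Fn0.
Qed.

Lemma tail_block j : tail (B j) (c j) \subset B j.
Proof. exact: tail_sub. Qed.

Lemma sum_split_at i (f : 'I_n.+1 -> nat) :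
  (\sum_j f j = \sum_(j : 'I_n.+1 | (j < i)%N) f j + f i + \sum_(j : 'I_n.+1 | (i < j)%N) f j)%N.
Proof.
rewrite (bigID (fun j : 'I_n.+1 => (j < i)%N)) /= -addnA; congr addn.
rewrite (bigD1 i) ?ltnn //=; congr addn; apply: eq_bigl => j.
by rewrite -leqNgt ltn_neqAle andbC; congr (_ && _); rewrite eq_sym.
Qed.

Lemma tails_before i : others i ->
  (\sum_(j : 'I_n.+1 | (j < i)%N) #|tail (B j) (c j)| + cells_before i = blocks_before i)%N.
Proof.
move=> /forallP oi; rewrite -big_split /=; apply: eq_bigr => j ji.
apply: card_tail; [exact: cell_sub|exact: cell_neq0|apply/eqP].
by have := oi j; rewrite (_ : j != i) //; apply: contraTneq ji => ->; rewrite ltnn.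
Qed.

Lemma signr_parity (k l : nat) : odd k = odd l -> (-1) ^+ k = (-1) ^+ l :> R.
Proof. by move=> e; rewrite -signr_odd e signr_odd. Qed.

Lemma join_tailD1 i a : a \in tail (B i) (c i) ->
  join_tail B c :\ a = (tail (B i) (c i) :\ a) :|: join_others i B c.
Proof.
move=> ai; rewrite (join_tailE i) setDUl; congr (_ :|: _); apply/setDidPl.
rewrite disjoint_sym disjoints1; apply/bigcupP => -[j ji aj].
by case/eqP: ji; rewrite -(mem_blk tail_block ai) (mem_blk tail_block aj).
Qed.

(** The boundary of a join is the sum of the boundaries of its factors; the sign
    of the factor [i] comes from the sizes of the previous tails, which are
    those of the blocks minus the degrees. *)
Lemma boundary_join :
  (-1) ^+ tensor_sign B c *:
    (if all_capped B c then simplex_boundary E (join_tail B c) else 0) =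
  \sum_i if others i then
     (-1) ^+ (tensor_sign B c + blocks_before i + cells_before i) *:
     (if gap (B i) (c i) == set0 then simplex_boundary (E_ i) (tail (B i) (c i)) else 0)
   else 0.
Proof.
case: (boolP (all_capped B c)) => [ac|nac]; last first.
  rewrite scaler0 big1 // => i _; move: nac; rewrite (all_cappedE i).
  by case: (others i) => //= /negbTE->; rewrite scaler0.
rewrite /simplex_boundary /join_tail (sum_join tail_block) scaler_sumr.
apply: eq_bigr => i _; move: (ac); rewrite (all_cappedE i) => /andP[oi ->]; rewrite oi.
rewrite !scaler_sumr; apply: eq_bigr => a ai; rewrite -/(join_tail B c) (join_tailD1 ai).
rewrite !scalerA -!exprD (rank_join tail_block mono (i := i)); last first.
  exact: (subsetP (tail_block i)).
congr (_ *: _); apply: signr_parity; have := tails_before oi; lia.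
Qed.

Lemma tensor_sign_minus i a : a \in B i ->
  (tensor_sign (block_minus a) c + cells_after i)%N = tensor_sign B c.
Proof.
move=> ai; rewrite /tensor_sign.
have Bj j : j != i -> block_minus a j = B j := fun ji => block_minus_other ai ji.
have Bi : #|B i| = #|block_minus a i|.+1 by rewrite (cardsD1 a) ai.
have [i_n|i_n] := ltnP i n; last first.
  have -> : cells_after i = 0%N.
    by rewrite big1 // => j ij; have := ltn_ord j; rewrite ltnS leqNgt (leq_ltn_trans i_n ij).
  rewrite addn0; apply: eq_bigr => j jn; rewrite Bj //.
  by apply: contraTneq jn => ->; rewrite -leqNgt.
rewrite [in LHS](bigD1 i) //= [in RHS](bigD1 i) //= Bi mulSn addnAC [(_ + cells_after i)%N]addnC.
by congr (_ + _)%N; apply: eq_bigr => j /andP[_ /Bj->].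
Qed.

(** A vertex outside the cell lies in one block, and its removal changes only the
    corresponding factor. *)
Lemma cap_on_faces :
  \sum_(a | [forall i, a \notin (c i).1])
     (-1) ^+ (a + tensor_sign (block_minus a) c) *: tensor_value (block_minus a) c =
  \sum_i if others i then
     \sum_(a in B i :\: (c i).1)
       (-1) ^+ (blocks_before i + rank (B i) a + (tensor_sign (block_minus a) c))
         *: cap_value (E_ i) (B i :\ a) (c i)
   else 0.
Proof.
rewrite (partition_big blk predT) //=; apply: eq_bigr => i _.
have aP a : ([forall i, a \notin (c i).1] && (blk a == i)) = (a \in B i :\: (c i).1).
  rewrite !inE; apply/andP/andP => [[/forallP h ->]//|[h /eqP bi]].
  rewrite bi eqxx; split=> //; apply/forallP => j; have [->//|ji] := eqVneq j i.
  apply: contra_neqN ji => /(subsetP (cell_sub j)); rewrite inE bi => /eqP->//.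
rewrite (eq_bigl _ _ aP).
transitivity (\sum_(a in B i :\: (c i).1) if others i then
       (-1) ^+ (blocks_before i + rank (B i) a + (tensor_sign (block_minus a) c))
         *: cap_value (E_ i) (B i :\ a) (c i) else 0); last first.
  by case: ifP => // _; rewrite big1.
apply: eq_bigr => a; rewrite inE => /andP[ac ai].
have Bj j : j != i -> block_minus a j = B j := fun ji => block_minus_other ai ji.
rewrite (tensor_valueE i) (eq_others_capped (D' := B) (c' := c)) //.
rewrite (eq_join_others (D' := B) (c' := c)) //; case: ifP; rewrite ?scaler0 // => _.
congr ((-1) ^+ (_ + _) *: _).
rewrite -[LHS]rank_setT -(bigcup_blocks blk) (rank_join _ mono ai) // => j.
Qed.

Lemma is_cell_update i (y : cface N) : is_cell blk (update c i y) =
  [&& y.1 \subset B i, y != (set0, false) & ~~ ((i == ord_max) && y.2)].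
Proof.
have /andP[/forallP cP cm] := c_cell; rewrite /is_cell; apply/andP/and3P.
  move=> [/forallP/(_ i)]; rewrite update_same => /andP[-> ->] um; split=> //.
  by apply: contra um => /andP[/eqP<-]; rewrite update_same.
move=> [yB yn ym]; split.
  by apply/forallP => j; rewrite ffunE; case: eqP => [->|_]; [rewrite yB|exact: cP].
by rewrite ffunE eq_sym; case: (i == _) ym.
Qed.

Lemma incidence_deg (y x : cface N) :
  x != (set0, false) -> incidence R y x != 0 -> cdeg y = (cdeg x).+1.
Proof.
move=> xn0; rewrite /incidence /cdeg => inc.
have [/existsP[a /andP[ay /eqP xE]]|nex] := boolP [exists a in y.1, x == (y.1 :\ a, y.2)].
  move: xn0; rewrite xE (cardsD1 a y.1) ay /= xpair_eqE negb_and.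
  by rewrite -card_gt0; case: (y.2); rewrite /= ?orbF; lia.
move: inc; rewrite big_pred0 ?add0r => [|a]; last first.
  by apply/negbTE; move: nex; rewrite negb_exists => /forallP/(_ a).
case y2: y.2; rewrite /= ?mul0r ?eqxx //.
have [xE _|_] := eqVneq x (y.1, false); last by rewrite mul0r eqxx.
by move: xn0; rewrite xE xpair_eqE andbT -card_gt0 /=; lia.
Qed.

Lemma incidence0 (x : cface N) : incidence R (set0, false) x = 0.
Proof. by rewrite /incidence /= mul0r addr0 big_pred0 // => a; rewrite inE. Qed.

Lemma tensor_sign_update i (y : cface N) : y.1 \subset B i -> cdeg y = (cdeg (c i)).+1 ->
  tensor_sign B (update c i y) = (tensor_sign B c + blocks_before i)%N.
Proof.
move=> yB dy; rewrite /tensor_sign (bigID (fun j : 'I_n.+1 => (j < i)%N)) /=.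
rewrite [in RHS](bigID (fun j : 'I_n.+1 => (j < i)%N)) /= addnAC.
congr addn; last first.
  apply: eq_bigr => j /andP[_ ij]; congr muln; apply: eq_bigr => l jl.
  by rewrite update_other //; apply: contraNneq ij => <-.
have jn j : ((j < n) && (j < i))%N = (j < i)%N.
  by case: (ltnP j i) => ji; rewrite ?andbF // andbT (leq_trans ji) // -ltnS.
rewrite (eq_bigl _ _ jn) [in RHS](eq_bigl _ _ jn) -big_split /=; apply: eq_bigr => j ji.
rewrite -mulnSr; congr muln; rewrite (bigD1 i) //= [in RHS](bigD1 i) //= update_same dy addSn.
by congr (_.+1 + _)%N; apply: eq_bigr => l /andP[_ li]; rewrite update_other.
Qed.

Definition agree_off i c d := [forall j, (j != i) ==> (c j == d j)].

(** The differential of the tensor product changes one factor [i] at a time, so the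
    cells [d] are indexed by the faces [y] of the cone of this factor.  The faces
    that do not occur in a cell, namely the empty one and those with an apex in the
    last factor, contribute zero. *)
Lemma cap_of_differential :
  \sum_(d : cell blk) (\sum_(i | agree_off i c (val d))
    (-1) ^+ cells_before i * (- (-1) ^+ cdeg (c i) * incidence R (val d i) (c i)))
      *: ((-1) ^+ tensor_sign B (val d) *: tensor_value B (val d)) =
  \sum_i if others i then
    - (-1) ^+ (tensor_sign B c + blocks_before i + cells_before i + cdeg (c i)) *:
    \sum_(y : cface N | y.1 \subset B i) incidence R y (c i) *: cap_value (E_ i) (B i) y
  else 0.
Proof.
under eq_bigr => d _ do rewrite scaler_suml.
rewrite (exchange_big_dep predT) //=; apply: eq_bigr => i _.
have := @big_sub_cond _ 0 +%R _ (is_cell blk) (fun d => agree_off i c d)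
 (fun d => ((-1) ^+ cells_before i * (- (-1) ^+ cdeg (c i) * incidence R (d i) (c i)))
   *: ((-1) ^+ tensor_sign B d *: tensor_value B d)).
move=> <-; rewrite (reindex_onto (update c i) (fun d => d i)) /=; last first.
  move=> d /andP[_ /forallP h]; apply/ffunP => j; rewrite ffunE.
  by have [->//|ji] := eqVneq j i; have := h j; rewrite ji => /eqP.
have yP y : [&& is_cell blk (update c i y), agree_off i c (update c i y) & update c i y i == y] =
    [&& y.1 \subset B i, y != (set0, false) & ~~ ((i == ord_max) && y.2)].
  rewrite update_same eqxx andbT is_cell_update (_ : agree_off _ _ _ = true) ?andbT //.
  by apply/forallP => j; apply/implyP => ji; rewrite update_other.
rewrite (eq_bigl _ _ (fun y => etrans (esym (andbA _ _ _)) (yP y))).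
have valE y : tensor_value B (update c i y) =
    if others i then cap_value (E_ i) (B i) y else 0.
  rewrite (tensor_valueE i) update_same (eq_others_capped (D' := B) (c' := c)) //; last first.
    by move=> j; exact: update_other.
  by rewrite (eq_join_others (D' := B) (c' := c)) // => j; exact: update_other.
case: ifP => oi; last by rewrite big1 // => y _; rewrite valE oi !scaler0.
rewrite [in RHS](bigID (fun y : cface N => (y != (set0, false)) && ~~ ((i == ord_max) && y.2))) /=.
rewrite [X in _ *: (_ + X)]big1 ?addr0 => [|y]; last first.
  rewrite negb_and !negbK => /andP[yB /orP[/eqP->|/andP[/eqP im y2]]].
    by rewrite incidence0 scale0r.
  rewrite /cap_value; case: eqP; rewrite ?scaler0 // => _.
  rewrite [y]surjective_pairing y2 tail_apex set0U E0 ?scaler0 //.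
  apply/setP => b; rewrite [RHS]inE; apply/negP; rewrite inE => /andP[].
  rewrite -im => /bigcupP[j ji bj]; rewrite inE (mem_blk tail_block bj).
  exact/negP.
rewrite scaler_sumr; apply: eq_bigr => y /andP[yB _]; rewrite update_same valE oi.
have [->|inc] := eqVneq (incidence R y (c i)) 0; first by rewrite !mulr0 !scale0r scaler0.
have dy := incidence_deg (cell_neq0 i) inc.
rewrite tensor_sign_update // !scalerA; congr (_ *: _).
by rewrite !exprD; ring.
Qed.

(** The first sum has the coefficients of the differential of [1_c], the second one
    runs over the faces of the simplex that contain the cell. *)
Lemma cell_leibniz :
  (-1) ^+ tensor_sign B c *:
    (if all_capped B c then simplex_boundary E (join_tail B c) else 0) =
  \sum_(d : cell blk) (\sum_(i | agree_off i c (val d))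
    (-1) ^+ cells_before i * (- (-1) ^+ cdeg (c i) * incidence R (val d i) (c i)))
      *: ((-1) ^+ tensor_sign B (val d) *: tensor_value B (val d))
  + (-1) ^+ degree *: \sum_(a | [forall i, a \notin (c i).1])
     (-1) ^+ (a + tensor_sign (block_minus a) c) *: tensor_value (block_minus a) c.
Proof.
rewrite boundary_join cap_of_differential cap_on_faces scaler_sumr -big_split /=.
apply: eq_bigr => i _; case: ifP => oi; last by rewrite scaler0 addr0.
rewrite factor_leibniz ?cell_sub ?cell_neq0 // scalerA -exprD scalerBr addrC scaleNr.
congr (_ + _); rewrite !scaler_sumr; apply: eq_bigr => a; rewrite inE => /andP[_ ai].
rewrite !scalerA -!exprD; congr (_ *: _); apply: signr_parity.
rewrite (sum_split_at i) -(tensor_sign_minus ai); congr odd.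
have reorder (t g b b' e r : nat) : (t + g + b + b' + e + r = b' + e + g + (b + r + t))%N by lia.
exact: reorder.
Qed.

End TensorLeibniz.

(** * The cap product as a join of tails *)

Section CapCell.
Import fintype boot.finset.
Variable N : nat.
Implicit Types (D F G S : {set 'I_N}) (x : cface N).

Lemma tail_neq0 D F : F \subset D -> F != set0 -> gap D (F, false) = set0 ->
  tail D (F, false) != set0.
Proof.
move=> FD F0 ge; have [k [_ _ _ ->]] := gap0_tail FD F0 ge.
by apply/set0Pn; exists k; rewrite setU11.
Qed.

Lemma cap_simplexE D F : F \subset D -> F != set0 ->
  cap_simplex D F = if gap D (F, false) == set0 then Some (tail D (F, false)) else None.
Proof.
move=> FD F0; rewrite /cap_simplex.
have capP G : compatible F G && (F :|: G == D) =
    (gap D (F, false) == set0) && (G == tail D (F, false)).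
  apply/andP/andP => [[/existsP[k /and4P[kF kG /forallP Fk /forallP kG']] /eqP FGD]|].
    have lek f : f \in F -> (f <= k)%N by move=> fF; have := Fk f; rewrite fF.
    have gek g : g \in G -> (k <= g)%N by move=> gG; have := kG' g; rewrite gG.
    have ge : gap D (F, false) = set0.
      apply/setP => b; rewrite [RHS]inE; apply/negP.
      rewrite -FGD !inE /below /= => /andP[/andP[/negbTE-> /= bG] /existsP[f /andP[fF]]].
      by apply/negP; rewrite -leqNgt (leq_trans (lek _ fF)) ?gek.
    rewrite ge eqxx; split=> //; apply/eqP/setP => b.
    have [k' [k'F lek' _ ->]] := gap0_tail FD F0 ge.
    have <- : k = k' by apply/val_inj/eqP; rewrite eqn_leq lek ?lek'.
    rewrite -FGD !inE; have [bG|bG] := boolP (b \in G).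
      rewrite orbT andbT; case: (boolP (b \in F)) => bF; rewrite ?orbT // orbF.
      by apply/esym/eqP/val_inj/eqP; rewrite eqn_leq lek ?gek.
    by rewrite orbF andNb orbF; apply/esym/negbTE; apply: contraNneq bG => ->.
  move=> [/eqP ge /eqP->]; have [k [kF lek big ->]] := gap0_tail FD F0 ge.
  split; last first.
    apply/eqP/setP => b; rewrite !inE; case: (boolP (b \in F)) => bF /=.
      by rewrite (subsetP FD).
    by case: eqP bF => [->|//]; rewrite kF.
  apply/existsP; exists k; rewrite kF setU11 /=; apply/andP; split.
    by apply/forallP => f; apply/implyP/lek.
  apply/forallP => g; apply/implyP => /setU1P[->//|/big/(_ _ kF)]; exact: ltnW.
case: pickP => [G|]; first by rewrite capP => /andP[-> /eqP->].
by move=> /(_ (tail D (F, false))); rewrite capP eqxx andbT => ->.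
Qed.

Variables (n : nat) (blk : {ffun 'I_N -> 'I_n.+1}).
Implicit Types (i j : 'I_n.+1) (c : cell blk).
Local Notation B := (block blk).

Lemma cap_factorE c i : cap_factor c i =
  if gap (B i) (val c i) == set0 then Some (tail (B i) (val c i), i != ord_max) else None.
Proof.
have cN := cell_neq0 (valP c) i; have cB := cell_sub (valP c) i.
have /andP[_ cM] := valP c.
rewrite /cap_factor /cap_cone; case: eqP => [im|/eqP im].
  move: cM cN cB; rewrite -im; case: (val c i) => F [] //= _ Fn0 FB.
  rewrite cap_simplexE //; first by case: ifP.
  by move: Fn0; rewrite xpair_eqE andbT.
case: (val c i) cN cB => F [] /= Fn0 FB.
  rewrite tail_apex; have -> : gap (B i) (F, true) = B i :\: F.
    by apply/setP => b; rewrite !inE andbT.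
  by rewrite setD_eq0 eqEsubset FB /=; case: ifP.
rewrite cap_simplexE //; first by case: ifP.
by move: Fn0; rewrite xpair_eqE andbT.
Qed.

Lemma tail_last_neq0 c : gap (B ord_max) (val c ord_max) = set0 ->
  tail (B ord_max) (val c ord_max) != set0.
Proof.
have [F cF F0] := cell_last (valP c); have := cell_sub (valP c) ord_max.
by rewrite cF => FB ge; exact: tail_neq0.
Qed.

(** After capping, the last factor is the only one without apex, so [mu] joins all
    the factors; the degrees add up because a coned tail of [r] vertices has
    dimension [r]. *)
Lemma cap_tensorE c : obind (@mu n N) (cap_tensor c) =
  if all_capped B (val c) then Some (join_tail B (val c)) else None.
Proof.
rewrite /cap_tensor.
rewrite (eq_forallb (P2 := fun i => gap (B i) (val c i) == set0)) => [|i]; last first.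
  by rewrite cap_factorE; case: ifP.
rewrite -/(all_capped B (val c)); case: ifP => //= /forallP ac.
set x := [ffun i => _].
have xE i : x i = (tail (B i) (val c i), i != ord_max).
  by rewrite ffunE cap_factorE ac.
rewrite /mu; have lE : [arg min_(j < ord_max | ~~ (x j).2) (j : nat)]%N = ord_max.
  by case: arg_minnP => [|i]; rewrite xE /= negbK // => /eqP.
rewrite lE.
have JE : \bigcup_(i : 'I_n.+1 | (i <= @ord_max n)%N) (x i).1 = join_tail B (val c).
  by apply: eq_big => i; rewrite ?xE // -ltnS ltn_ord.
rewrite JE ifT // /join_tail (card_join (@tail_block _ _ blk (val c))).
rewrite (bigD1 ord_max) // [X in _ == X](bigD1 ord_max) //= xE eqxx /cdeg /= addn0 -addSn.
rewrite prednK ?card_gt0; last by apply: tail_last_neq0; apply/eqP/ac.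
rewrite eqn_add2l; apply/eqP/eq_bigr => i im; by rewrite xE im addn1.
Qed.

End CapCell.

(** * Faces of filtered simplices *)

Section Faces.
Import fintype boot.finset.
Variables (K : realType) (X : filtered_space).
Implicit Types (s t : fsimplex K X).

Lemma stdsimplex_map_id (M : nat) (f : 'I_M -> 'I_M) (x : stdsimplex K M) :
  f =1 id -> stdsimplex_map f x = x.
Proof.
move=> fid; apply/val_inj/rowP => b; rewrite mxE (big_pred1 b) // => a.
by rewrite /= fid.
Qed.

Lemma stdsimplex_map_comp (M P Q : nat) (f : 'I_M -> 'I_P) (g : 'I_P -> 'I_Q)
    (h : 'I_M -> 'I_Q) (x : stdsimplex K M) :
  g \o f =1 h -> stdsimplex_map g (stdsimplex_map f x) = stdsimplex_map h x.
Proof.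
move=> gf; apply/val_inj/rowP => b; rewrite !mxE.
rewrite [RHS](partition_big f (fun a => g a == b)) /= => [|a]; last by rewrite -gf.
apply: eq_bigr => a ab; rewrite mxE; apply: eq_bigl => a'; rewrite -gf /=.
by case: (altP (f a' =P a)) => [->|]; rewrite ?ab ?andbF.
Qed.

(** Equality of simplices whose numbers of vertices are only propositionally
    equal. *)
Lemma fsimplex_eq s t (e : fs_nv s = fs_nv t) :
  (forall a, fs_blk s a = fs_blk t (cast_ord e a)) ->
  (forall x, @fs_map K X s x = @fs_map K X t (stdsimplex_map (cast_ord e) x)) -> s = t.
Proof.
case: s t e => [M b f H1 H2 H3] [M' b' f' H1' H2' H3'] /= e; case: M' / e b' f' H1' H2' H3'.
move=> b' f' H1' H2' H3' bb ff.
have eb : b = b' by apply/ffunP => a; rewrite bb cast_ord_id.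
have ef : f = f'.
  by apply/funext => x; rewrite ff stdsimplex_map_id // => a; rewrite cast_ord_id.
by subst b' f'; congr FSimplex; exact: Prop_irrelevance.
Qed.

Section EnumVal.
Variables (s : fsimplex K X) (G : {set 'I_(fs_nv s)}).

Lemma enum_val_lt (a b : 'I_#|G|) : (enum_val a < enum_val b)%N = (a < b)%N.
Proof.
apply/idP/idP; first by rewrite !ltnNge; apply: contra; exact: enum_val_ord_mono.
move=> ab; rewrite ltn_neqAle enum_val_ord_mono ?(ltnW ab) // andbT.
by apply: contraTneq ab => /val_inj/enum_val_inj->; rewrite ltnn.
Qed.

Lemma imset_enum_val (P : pred 'I_(fs_nv s)) :
  enum_val @: [set a : 'I_#|G| | P (enum_val a)] = [set b in G | P b].
Proof.
apply/setP => b; rewrite inE; apply/imsetP/andP => [[a]|[bG Pb]].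
  by rewrite inE => Pa ->; split=> //; exact: enum_valP.
by exists (enum_rank_in bG b); rewrite ?inE enum_rankK_in.
Qed.

Lemma rank_enum_val (a : 'I_#|G|) : rank G (enum_val a) = a.
Proof.
rewrite /rank -(imset_enum_val (fun b => (b < enum_val a)%N)) card_imset; last exact: enum_val_inj.
rewrite -[RHS]rank_setT; apply: eq_card => b; by rewrite !inE enum_val_lt.
Qed.

Lemma rank_imset (B : {set 'I_#|G|}) a : rank (enum_val @: B) (enum_val a) = rank B a.
Proof.
rewrite /rank -(card_imset [set b in B | (b < a)%N] (@enum_val_inj _ (mem G))).
apply: eq_card => b; rewrite !inE; apply/andP/imsetP.
  by move=> [/imsetP[b' b'B ->]]; rewrite enum_val_lt => b'a; exists b'; rewrite ?inE ?b'B.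
by move=> [b']; rewrite inE => /andP[b'B b'a] ->; rewrite imset_f // enum_val_lt.
Qed.

End EnumVal.

(** Both sides enumerate the same vertices in increasing order, and a vertex is
    determined by its rank. *)
Lemma face_face s (A : {set 'I_(fs_nv s)}) (B : {set 'I_#|A|}) :
  face (s := face A) B = face (enum_val @: B).
Proof.
have e : #|B| = #|[set enum_val a | a in B]| by rewrite card_imset //; exact: enum_val_inj.
have eV (a : 'I_#|B|) :
    enum_val (enum_val a : 'I_#|A|) = enum_val (A := mem (enum_val @: B)) (cast_ord e a).
  have mB : enum_val (enum_val a : 'I_#|A|) \in enum_val @: B by rewrite imset_f ?enum_valP.
  rewrite -(enum_rankK_in mB mB); congr enum_val; apply/val_inj => /=.
  rewrite -(@rank_enum_val s (enum_val @: B)) enum_rankK_in // rank_imset.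
  exact: (@rank_enum_val (face A) B).
apply: (@fsimplex_eq (face (s := face A) B) (face (enum_val @: B)) e) => [a|x] /=.
  by rewrite !ffunE eV.
rewrite /face_map /=; congr fs_map.
pose both (a : 'I_#|B|) : 'I_(fs_nv s) := enum_val (enum_val a : 'I_#|A|).
rewrite !(@stdsimplex_map_comp _ _ _ _ _ both) // => a; rewrite /both /= ?eV //.
Qed.

Lemma imset_enum_val_C1 s (G : {set 'I_(fs_nv s)}) (a : 'I_#|G|) :
  enum_val @: [set~ a] = G :\ enum_val a.
Proof.
rewrite (_ : [set~ a] = [set a' | enum_val a' != enum_val a]); last first.
  by apply/setP => a'; rewrite !inE (inj_eq enum_val_inj).
by rewrite (imset_enum_val G (fun b => b != enum_val a)); apply/setP => b; rewrite !inE andbC.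
Qed.

Lemma regular_face s (G : {set 'I_(fs_nv s)}) :
  regular (face G) = (G :&: block (fs_blk s) ord_max != set0).
Proof.
apply/existsP/set0Pn => [[a]|[b]].
  by rewrite /= ffunE => ab; exists (enum_val a); rewrite !inE ab enum_valP.
rewrite !inE => /andP[bG bm]; exists (enum_rank_in bG b).
by rewrite /= ffunE enum_rankK_in.
Qed.

End Faces.

Section FaceChains.
Import fintype boot.finset.
Variables (K : realType) (R : comPzRingType) (X : filtered_space).

Lemma linext_basis (T : choiceType) (V : lmodType R) (f : T -> V) t :
  linext f (Defs.basis R t) = f t.
Proof.
have bE u : freemod_fun (Defs.basis R t) u = (u == t)%:R by [].
rewrite (@linextE _ _ _ _ _ (classical_sets.set1 t)) //; last first.
  by move=> u; rewrite bE /=; case: (u =P t) => // _; rewrite eqxx.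
by rewrite fset_set1 big_seq_fset1 bE eqxx scale1r.
Qed.

Variable s : fsimplex K X.
Implicit Types (G : {set 'I_(fs_nv s)}).

(** Irregular faces count as zero, so that the tame differential becomes the full
    simplicial boundary. *)
Definition face_chain G : chains K R X := if regular (face G) then Defs.basis R (face G) else 0.

Lemma face_chain0 G : G :&: block (fs_blk s) ord_max = set0 -> face_chain G = 0.
Proof. by move=> G0; rewrite /face_chain regular_face G0 eqxx. Qed.

Lemma tame_diff_face G : tame_diff (Defs.basis R (face G)) = simplex_boundary face_chain G.
Proof.
rewrite /tame_diff linext_basis /tame_diff_simplex /simplex_boundary big_mkcond /=.
rewrite [RHS]big_enum_val; apply: eq_bigr => a _.
rewrite face_face imset_enum_val_C1 rank_enum_val /face_chain.
by case: ifP; rewrite ?scaler0.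
Qed.

Lemma tame_diff_face_chain G : regular (face G) ->
  tame_diff (face_chain G) = simplex_boundary face_chain G.
Proof. by move=> h; rewrite -tame_diff_face /face_chain h. Qed.

End FaceChains.

(** * The cap product on the faces of a simplex *)

Section CapFaces.
Import fintype boot.finset.
Variables (K : realType) (R : comPzRingType) (X : filtered_space).
Implicit Types (s : rsimplex K X) (w : cochains K R X).

Local Notation B s := (block (fs_blk (val s))).

Lemma join_tail_regular s (c : cell (fs_blk (val s))) : all_capped (B s) (val c) ->
  regular (face (join_tail (B s) (val c))).
Proof.
move=> /forallP ac; rewrite regular_face /join_tail (join_block (@tail_block _ _ _ (val c))).
by apply: tail_last_neq0; apply/eqP/ac.
Qed.

Lemma cap_cellE s (c : cell (fs_blk (val s))) : cap_cell R c =
  (-1) ^+ tensor_sign (B s) (val c)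
    *: tensor_value (@face_chain K R X (val s)) (B s) (val c).
Proof.
rewrite /cap_cell cap_tensorE /tensor_value; case: ifP => [ac|]; last by rewrite scaler0.
by rewrite /face_chain join_tail_regular.
Qed.

Section ImageCell.
Variables (M N n : nat) (phi : 'I_M -> 'I_N).
Hypothesis phi_lt : forall a b : 'I_M, (phi a < phi b)%N = (a < b)%N.

Lemma lt_mono_inj : injective phi.
Proof.
by move=> a b e; apply/val_inj; case: (ltngtP a b) => //; rewrite -phi_lt e ltnn.
Qed.

Lemma below_image (x : cface M) a :
  below (phi @: x.1, x.2) (phi a) = below x a.
Proof.
rewrite /below /=; congr (_ || _); apply/existsP/existsP.
  move=> [_ /andP[/imsetP[f fx ->]]]; rewrite phi_lt => af.
  by exists f; rewrite fx.
by move=> [f /andP[fx af]]; exists (phi f); rewrite phi_lt af imset_f.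
Qed.

Lemma gap_image (D : {set 'I_M}) (x : cface M) :
  gap (phi @: D) (phi @: x.1, x.2) = phi @: gap D x.
Proof.
apply/setP => b; apply/idP/imsetP => [|[a]]; rewrite inE.
  move=> /andP[/setDP[/imsetP[a aD ->]] /=]; rewrite below_image => ax ab.
  by exists a => //; rewrite !inE ab aD !andbT; apply: contra ax; exact: imset_f.
move=> /andP[/setDP[aD ax] ab] ->; rewrite inE below_image ab andbT inE (imset_f _ aD) andbT.
by rewrite mem_imset //; exact: lt_mono_inj.
Qed.

Lemma tail_image (D : {set 'I_M}) (x : cface M) :
  tail (phi @: D) (phi @: x.1, x.2) = phi @: tail D x.
Proof.
apply/setP => b; apply/idP/imsetP => [|[a]]; rewrite inE.
  move=> /andP[/imsetP[a aD ->] /= /andP[x2 /forallP h]].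
  exists a => //; rewrite inE aD x2 /=; apply/forallP => f; apply/implyP => fx.
  by have := h (phi f); rewrite imset_f //= leqNgt phi_lt -leqNgt.
move=> /andP[aD /andP[x2 /forallP h]] ->; rewrite inE imset_f //= x2 /=.
apply/forallP => b'; apply/implyP => /imsetP[f fx ->].
by have := h f; rewrite fx /= leqNgt -phi_lt -leqNgt.
Qed.

Lemma cdeg_image (x : cface M) : cdeg (phi @: x.1, x.2) = cdeg x.
Proof. by rewrite /cdeg card_imset //; exact: lt_mono_inj. Qed.

Variables (D : 'I_n.+1 -> {set 'I_M}) (D' : 'I_n.+1 -> {set 'I_N}).
Variables (c : {ffun 'I_n.+1 -> cface M}) (c' : {ffun 'I_n.+1 -> cface N}).
Hypothesis DD' : forall i, D' i = phi @: D i.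
Hypothesis cc' : forall i, c' i = (phi @: (c i).1, (c i).2).

Lemma all_capped_image : all_capped D' c' = all_capped D c.
Proof. by apply: eq_forallb => i; rewrite DD' cc' gap_image imset_eq0. Qed.

Lemma join_tail_image : join_tail D' c' = phi @: join_tail D c.
Proof.
apply/setP => b; apply/bigcupP/imsetP => [[i _]|[a /bigcupP[i _ ai] ->]].
  rewrite DD' cc' tail_image => /imsetP[a ai ->]; exists a => //.
  by apply/bigcupP; exists i.
by exists i => //; rewrite DD' cc' tail_image imset_f.
Qed.

Lemma tensor_sign_image : tensor_sign D' c' = tensor_sign D c.
Proof.
apply: eq_bigr => j _; rewrite DD' card_imset; last exact: lt_mono_inj.
by congr muln; apply: eq_bigr => i _; rewrite cc' cdeg_image.
Qed.

End ImageCell.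

(** The cells of a face are the cells of the simplex that avoid the deleted vertex,
    and a compatible family has the same coefficients on both. *)
Lemma cap_rsimplex_face w s (a : 'I_(fs_nv (val s))) (reg : regular (face [set~ a])) :
  compatible_family w ->
  cap_rsimplex w (exist (fun t : fsimplex K X => regular t) _ reg) =
  \sum_(c : cell (fs_blk (val s)) | [forall i, a \notin (val c i).1])
    w s c *: ((-1) ^+ tensor_sign (block_minus (fs_blk (val s)) a) (val c) *:
      tensor_value (@face_chain K R X (val s)) (block_minus (fs_blk (val s)) a) (val c)).
Proof.
move=> wC; rewrite /cap_rsimplex.
pose phi (b : 'I_#|[set~ a]|) : 'I_(fs_nv (val s)) := enum_val b.
have phi_lt (b b' : 'I_#|[set~ a]|) : (phi b < phi b')%N = (b < b')%N := enum_val_lt b b'.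
have phi_a (b : 'I_#|[set~ a]|) : phi b != a by have := enum_valP b; rewrite !inE.
have phi_surj b : b != a -> exists b', b = phi b'.
  move=> ba; have bG : b \in [set~ a] by rewrite !inE.
  by exists (enum_rank_in bG b); rewrite /phi enum_rankK_in.
pose h := @cell_map (fdim X) _ _ (fs_blk (val s)) phi.
have h_inj : injective h.
  move=> c d e; apply/val_inj/ffunP => i.
  have /ffunP/(_ i) := congr1 val e; rewrite !ffunE => -[e1 e2].
  rewrite [LHS]surjective_pairing e2 [RHS]surjective_pairing; congr pair.
  exact: imset_inj (lt_mono_inj phi_lt) _ _ e1.
have hP (d : cell (fs_blk (val s))) : [forall i, a \notin (val d i).1] = (d \in h @: setT).
  apply/forallP/imsetP => [ad|[c _ ->] i]; last first.
    rewrite ffunE; apply/imsetP => -[b _ ab]; by have := phi_a b; rewrite -ab eqxx.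
  have preK i : phi @: (phi @^-1: (val d i).1) = (val d i).1.
    apply/setP => b; apply/imsetP/idP => [[b']|bd]; first by rewrite inE => ? ->.
    have [|b' bE] := phi_surj b; first by apply: contraNneq (ad i) => <-.
    by exists b'; rewrite ?inE -?bE.
  pose c : {ffun 'I_(fdim X).+1 -> cface #|[set~ a]|} :=
    [ffun i => (phi @^-1: (val d i).1, (val d i).2)].
  have /andP[/forallP dP dm] := valP d.
  have cP : is_cell [ffun b => fs_blk (val s) (phi b)] c.
    apply/andP; split; last by rewrite ffunE.
    apply/forallP => i; have /andP[dB dn] := dP i; rewrite ffunE /=; apply/andP; split.
      by apply/subsetP => b; rewrite !inE ffunE => /(subsetP dB); rewrite inE.
    apply: contra dn; rewrite xpair_eqE => /andP[/eqP e /eqP e2].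
    by rewrite [val d i]surjective_pairing -(preK i) e imset0 e2.
  exists (exist (fun c => is_cell [ffun b => fs_blk (val s) (phi b)] c) c cP) => //.
  by apply/val_inj/ffunP => i; rewrite !ffunE /= preK -surjective_pairing.
rewrite (eq_bigl _ _ hP) big_imset /=; last by move=> ? ? _ _; exact: h_inj.
rewrite big_mkcond [RHS]big_mkcond /=; apply: eq_bigr => c _; rewrite inE wC.
congr (_ *: _).
have DD i : block_minus (fs_blk (val s)) a i = phi @: block (fs_blk (face [set~ a])) i.
  apply/setP => b; rewrite !inE; apply/andP/imsetP => [[/phi_surj[b' ->] bi]|[b' bi ->]].
    by exists b'; rewrite // inE /= ffunE.
  by move: bi; rewrite inE /= ffunE => ->; rewrite phi_a.
have cc i : val (h c) i = (phi @: (val c i).1, (val c i).2) by rewrite ffunE.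
rewrite cap_cellE (tensor_sign_image phi_lt DD cc); congr (_ *: _).
rewrite /tensor_value (all_capped_image phi_lt DD cc) (join_tail_image phi_lt DD cc).
by case: ifP => // _; rewrite /face_chain /= face_face.
Qed.

End CapFaces.

(** * The Leibniz rule for chains *)

Section LinearExtension.
Variables (R : pzRingType) (T : choiceType) (V W : lmodType R).

Lemma linext_comp (f : T -> V) (L : {linear V -> W}) (x : freemod R T) :
  L (linext f x) = linext (L \o f) x.
Proof.
pose A := classical_sets.mkset (fun t => freemod_fun x t != 0).
rewrite !(@linextE _ _ _ _ _ A) //; try exact: freemod_finite.
by rewrite linear_sum; apply: eq_bigr => t _; rewrite linearZ.
Qed.

Lemma linextD (f g : T -> V) (x : freemod R T) :
  linext (fun t => f t + g t) x = linext f x + linext g x.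
Proof.
pose A := classical_sets.mkset (fun t => freemod_fun x t != 0).
rewrite !(@linextE _ _ _ _ _ A) //; try exact: freemod_finite.
by rewrite -big_split; apply: eq_bigr => t _; rewrite scalerDr.
Qed.

End LinearExtension.

Lemma linextZ (R : comPzRingType) (T : choiceType) (V : lmodType R) (a : R)
    (f : T -> V) (x : freemod R T) :
  linext (fun t => a *: f t) x = a *: linext f x.
Proof.
pose A := classical_sets.mkset (fun t => freemod_fun x t != 0).
rewrite !(@linextE _ _ _ _ _ A) //; try exact: freemod_finite.
by rewrite scaler_sumr; apply: eq_bigr => t _; rewrite !scalerA mulrC.
Qed.

Section Cap.
Variables (K : realType) (R : comPzRingType) (X : filtered_space).
Implicit Types (s : rsimplex K X) (t : fsimplex K X) (w : cochains K R X) (x : chains K R X).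

Definition cap_fsimplex w t : chains K R X :=
  if insub t is Some s then cap_rsimplex w (s : rsimplex K X) else 0.

Lemma cap_fsimplex_regular w t (reg : regular t) :
  cap_fsimplex w t = cap_rsimplex w (exist (fun t : fsimplex K X => regular t) t reg).
Proof. by rewrite /cap_fsimplex insubT. Qed.

Lemma cap_fsimplex_irregular w t : ~~ regular t -> cap_fsimplex w t = 0.
Proof. by move=> nreg; rewrite /cap_fsimplex insubN. Qed.

(** The sum that defines the cap product runs over the regular simplices only;
    extended by zero, it is a linear extension over all simplices. *)
Lemma capE w x : cap w x = linext (cap_fsimplex w) x.
Proof.
rewrite /cap /linext.
rewrite -(@fsbig_widen _ _ _ _ (range (val : rsimplex K X -> _))) //; last first.
  move=> t [_ /= nt]; rewrite cap_fsimplex_irregular ?scaler0 //.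
  by apply/negP => reg; apply: nt; exists (exist (fun t : fsimplex K X => regular t) t reg).
rewrite (reindex_fsbig (val : rsimplex K X -> _) [set: rsimplex K X]%classic) /=.
  by apply: eq_fsbigr => s _; rewrite /cap_fsimplex valK.
by split=> [s _|s s' _ _|//]; [exists s|exact: val_inj].
Qed.

Lemma cap_linear_r w : linear (cap w).
Proof. by move=> a x y; rewrite !capE linearP. Qed.

Lemma cap_linear_l x : linear (fun w : cochains K R X => cap w x).
Proof.
move=> a v w; rewrite !capE -linextZ -linextD; congr (linext _ x); apply/funext => t.
rewrite /cap_fsimplex; case: insubP => [s _ _|_]; last by rewrite scaler0 addr0.
rewrite /cap_rsimplex scaler_sumr -big_split; apply: eq_bigr => c _.
by rewrite -[(a *: v + w) s c]/((a *: v s + w s) c) !ffunE scalerDl scalerA.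
Qed.

Lemma regular_of_face t (G : {set 'I_(fs_nv t)}) : regular (face G) -> regular t.
Proof.
rewrite regular_face => /finset.set0Pn[b]; rewrite !inE => /andP[_ bm].
by apply/existsP; exists b.
Qed.

(** A cell has a vertex in the last block, which survives in every face that
    contains the cell. *)
Lemma cell_avoiding_regular s (c : cell (fs_blk (val s))) a :
  [forall i, a \notin (val c i).1] -> regular (face [set~ a]%SET).
Proof.
move=> /forallP ac; rewrite regular_face.
have [F cF /finset.set0Pn[b bF]] := cell_last (valP c).
have := cell_sub (valP c) ord_max; have := ac ord_max; rewrite cF => aF FB.
apply/finset.set0Pn; exists b; rewrite !inE; have := fintype.subsetP FB b bF; rewrite inE => ->.
by rewrite andbT; apply: contraNneq aF => <-.
Qed.

Lemma rsimplex_leibniz w k s : compatible_family w -> homogeneous k w ->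
  tame_diff (cap_rsimplex w s) = cap_rsimplex (cochain_diff w) s +
    (-1) ^+ `|k|%N *: \sum_(a | regular (face (s := val s) [set~ a]%SET))
       (-1) ^+ a *: cap_fsimplex w (face [set~ a]%SET).
Proof.
move=> wC wk; rewrite {1}/cap_rsimplex linear_sum /=.
set B := block (fs_blk (val s)); set E := @face_chain K R X (val s).
have dcap (c : cell (fs_blk (val s))) : @tame_diff K R X (w s c *: cap_cell R c) =
    \sum_d (w s c * diff_coef R c d) *: cap_cell R d
    + (-1) ^+ `|k|%N *: \sum_(a | [forall i, a \notin (val c i).1])
       (-1) ^+ a *: (w s c *: ((-1) ^+ tensor_sign (block_minus (fs_blk (val s)) a) (val c) *:
        tensor_value E (block_minus (fs_blk (val s)) a) (val c))).
  have tame_diffZ (a : R) (x : chains K R X) : tame_diff (a *: x) = a *: tame_diff x.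
    exact: linearZ.
  have dtensor : tame_diff (tensor_value E B (val c)) =
      if all_capped B (val c) then simplex_boundary E (join_tail B (val c)) else 0.
    rewrite /tensor_value; case: ifP => ac; last exact: linear0.
    by rewrite tame_diff_face_chain // join_tail_regular.
  rewrite tame_diffZ cap_cellE tame_diffZ dtensor.
  rewrite (cell_leibniz (@fs_blk_mono _ _ (val s)) (@face_chain0 _ _ _ _) (valP c)).
  rewrite scalerDr; congr (_ + _).
    by rewrite scaler_sumr; apply: eq_bigr => d _; rewrite -scalerA cap_cellE.
  have [->|wc] := eqVneq (w s c) 0.
    rewrite scale0r big1 ?scaler0 // => a _; by rewrite scale0r scaler0.
  rewrite -(wk _ _ wc) absz_nat [LHS]scalerA mulrC -scalerA; congr (_ *: _).
  rewrite scaler_sumr; apply: eq_bigr => a _.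
  by rewrite !scalerA; congr (_ *: _); rewrite exprD mulrCA mulrA.
rewrite (eq_bigr _ (fun c _ => dcap c)) big_split /=; congr (_ + _).
  rewrite exchange_big /=; apply: eq_bigr => d _; rewrite -scaler_suml; congr (_ *: _).
  by rewrite /cochain_diff ffunE.
rewrite -scaler_sumr; congr (_ *: _).
rewrite (exchange_big_dep (fun a => regular (face (s := val s) [set~ a]%SET))) /=; last first.
  by move=> c a _; exact: cell_avoiding_regular.
apply: eq_bigr => a reg; rewrite -scaler_sumr; congr (_ *: _).
by rewrite cap_fsimplex_regular cap_rsimplex_face.
Qed.

(** The rule holds for arbitrary chains, as both sides vanish on the simplices that
    are not regular. *)
Lemma leibniz w k x : compatible_family w -> homogeneous k w ->
  tame_diff (cap w x) = cap (cochain_diff w) x + (-1) ^+ `|k|%N *: cap w (tame_diff x).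
Proof.
move=> wC wk.
have diff_cap : tame_diff (linext (cap_fsimplex w) x) =
    linext (@tame_diff K R X \o cap_fsimplex w) x.
  exact: linext_comp.
have cap_diff : linext (cap_fsimplex w) (tame_diff x) =
    linext (linext (cap_fsimplex w) \o @tame_diff_simplex K R X) x.
  exact: linext_comp.
rewrite !capE diff_cap cap_diff -linextZ -linextD; congr (linext _ x).
apply/funext => t /=; have [reg|nreg] := boolP (regular t).
  rewrite !(cap_fsimplex_regular _ reg) (rsimplex_leibniz _ wC wk); congr (_ + _ *: _).
  rewrite /tame_diff_simplex linear_sum /=; apply: eq_bigr => a _.
  by rewrite linearZ /= linext_basis.
rewrite !cap_fsimplex_irregular // linear0 add0r /tame_diff_simplex big_pred0 => [|a].
  by rewrite linear0 scaler0.
by apply: contraNF nreg; exact: regular_of_face.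
Qed.

End Cap.

(** * Allowability *)

Section Allowability.
Variables (K : realType) (R : comPzRingType) (X : filtered_space).
Implicit Types (s : rsimplex K X) (t : fsimplex K X) (w : cochains K R X) (x : chains K R X).
Implicit Types (S : stratum X) (p q : perversity X).

Local Notation n := (fdim X).

Lemma stratum_layer S (y : X) : str_set S y -> layer (str_idx S) y.
Proof.
by have [z _ ->] := str_comp S; exact: connected_component_sub.
Qed.

(** Otherwise the barycentric coordinates that vanish because the point lies in the
    skeleton [i] would put it in the previous skeleton, or would all vanish if
    [i = 0]. *)
Lemma meets_vertex t S : Defs.meets t S -> exists a, fs_blk t a = str_idx S.
Proof.
move=> [_ [[x _ <-] /stratum_layer [xi nxi]]].
have xS := valP x; rewrite inE in xS; case: xS => x0 x1.
apply: contrapT => nex; have nei a : (fs_blk t a : nat) <> str_idx S.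
  by move=> e; apply: nex; exists a; exact: val_inj.
move: xi nxi nei; case: (str_idx S) => i i_n /= xi nxi nei.
have /fs_map_filtered xi0 : skel X (Ordinal i_n) (@fs_map K X t x) by [].
case: i i_n xi nxi nei xi0 => [|i] i_n xi nxi nei xi0.
  have := x1; rewrite big1 => [/eqP|a _]; first by rewrite eq_sym oner_eq0.
  by apply: xi0; rewrite /= lt0n; apply/eqP/nei.
apply: nxi => /=; have i_n' : (i < n.+1)%N by exact: ltnW.
apply/(@fs_map_filtered _ _ t (Ordinal i_n')) => a /= ia; apply: xi0 => /=.
by rewrite ltn_neqAle ia andbT; apply/eqP => /esym/nei.
Qed.

Lemma codimK S : (n - codim S)%N = str_idx S.
Proof. by rewrite /codim subKn // -ltnS. Qed.

Lemma meets_face t (G : {set 'I_(fs_nv t)}) S : Defs.meets (face G) S -> Defs.meets t S.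
Proof.
by move=> [_ [[x _ <-] xS]]; eexists; split; [eexists; first by []; reflexivity|exact: xS].
Qed.

Section CapFace.
Variables (s : rsimplex K X) (c : cell (fs_blk (val s))).
Local Notation B := (block (fs_blk (val s))).
Local Notation J := (join_tail B (val c)).
Hypothesis ac : all_capped B (val c).

Lemma card_tail_cell i : (#|tail (B i) (val c i)| + cdeg (val c i))%N = #|B i|.
Proof.
apply: card_tail; [exact: (cell_sub (valP c))|exact: (cell_neq0 (valP c))|apply/eqP].
by move/forallP: ac; apply.
Qed.

Lemma cap_face_dim : fs_dim (face J) = fs_dim (val s) - (cell_deg c)%:Z.
Proof.
rewrite /fs_dim /= (card_join (@tail_block _ _ _ (val c))).
have subtract (u d v : nat) : (u + d = v)%N -> u%:Z - 1 = v%:Z - 1 - d%:Z by lia.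
apply: subtract.
rewrite /cell_deg -big_split /= (eq_bigr _ (fun i _ => card_tail_cell i)).
by rewrite -(card_join (T := B) (blk := fs_blk (val s))) // bigcup_blocks cardsT card_ord.
Qed.

Lemma card_join_factors_le t (i : 'I_n.+1) :
  #|[set a | (fs_blk t a <= i)%N]%SET| = (\sum_(j : 'I_n.+1 | (j <= i)%N) #|block (fs_blk t) j|)%N.
Proof.
rewrite (card_blocks (fs_blk t)) [RHS]big_mkcond; apply: eq_bigr => j _.
case: ifP => ji; last first.
  apply/eqP; rewrite cards_eq0; apply/eqP/finset.setP => a; rewrite !inE.
  by case: eqP => [->|]; rewrite ?ji ?andbF.
by apply: eq_card => a; rewrite !inE; case: eqP => [->|]; rewrite ?ji ?andbF.
Qed.

Lemma card_block_face i : #|block (fs_blk (face J)) i| = #|tail (B i) (val c i)|.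
Proof.
rewrite -(card_imset _ (@enum_val_inj _ (mem J))).
rewrite (_ : block _ i = [set a | fs_blk (val s) (enum_val a) == i]%SET); last first.
  by apply/finset.setP => a; rewrite !inE ffunE.
rewrite (imset_enum_val J (fun b => fs_blk (val s) b == i)).
rewrite -(join_block (@tail_block _ _ _ (val c)) i).
by apply: eq_card => b; rewrite !inE.
Qed.

(** The face has a vertex in the block of [S], so [1_c] has no apex there and its
    norm along [S] is the total degree of the later factors; the earlier factors
    lose the same number of vertices in the face and in its join up to [S]. *)
Lemma cap_face_allowable p q : simplex_allowable q (val s) ->
  (forall S, singular S -> Defs.meets (val s) S -> (cell_norm (codim S) c <= p S)%E) ->
  simplex_allowable (perv_add p q) (face J).
Proof.
move=> sq cp S JS; have sS := meets_face JS.
have [a ai] := meets_vertex JS; have := sq S sS; have := cp S ^~ sS.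
rewrite /join_dim codimK !card_join_factors_le cap_face_dim /cell_norm codimK inord_val /=.
set i := str_idx S in ai *.
have ti : tail (B i) (val c i) != finset.set0.
  rewrite -cards_eq0 -card_block_face -lt0n; apply/card_gt0P; exists a.
  by rewrite inE ai.
have ci : (val c i).2 = false.
  by apply: contraNF ti => c2; rewrite [val c i]surjective_pairing c2 tail_apex.
rewrite ci (eq_bigr _ (fun j _ => card_block_face j)).
set T := (\sum_(j < n.+1 | (j <= i)%N) #|tail _ _|)%N.
set b := (\sum_(j < n.+1 | (j <= i)%N) #|B j|)%N.
set g := (\sum_(j < n.+1 | (i < j)%N) cdeg (val c j))%N.
set l := (\sum_(j < n.+1 | (j <= i)%N) cdeg (val c j))%N.
have Tb : (T + l = b)%N by rewrite -big_split /=; apply: eq_bigr => j _; exact: card_tail_cell.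
have lg : cell_deg c = (l + g)%N.
  rewrite /cell_deg (bigID (fun j : 'I_n.+1 => (j <= i)%N)) /=; congr addn.
  by apply: eq_bigl => j; rewrite -ltnNge.
have T0 : (0 < T)%N by rewrite /T (bigD1 i) //= addn_gt0 card_gt0 ti.
have -> : (T == 0) = false by exact: gtn_eqF.
have -> : (b == 0) = false by apply: gtn_eqF; rewrite -Tb addn_gt0 T0.
rewrite lg; have [sg|nsg] := pselect (singular S); last first.
  rewrite /singular in nsg; have c0 : codim S = 0%N by lia.
  rewrite (perv_regular p nsg) (perv_regular q nsg) c0 => _.
  have g0 : g = 0%N.
    rewrite /g big_pred0 // => j; apply/negbTE; rewrite -leqNgt.
    by have := codimK S; rewrite c0 subn0 -/i => <-; rewrite -ltnS.
  rewrite !adde0 !lee_fin g0; move: Tb; lia.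
clearbody T b g l; move: (fs_dim _) (codim S) => d e /(_ sg).
by case: (p S) => [pS| |]; case: (q S) => [qS| |] //=; rewrite ?lee_fin ?leey //; move: Tb; lia.
Qed.

End CapFace.
End Allowability.

(** * The cap product on complexes and on homology *)

Section Support.
Variables (K : realType) (R : comPzRingType) (X : filtered_space).
Implicit Types (s : rsimplex K X) (t : fsimplex K X) (w : cochains K R X) (x y : chains K R X).
Implicit Types (P Q : fsimplex K X -> Prop).

Lemma supported_sum P (I : Type) (r : seq I) (A : pred I) (f : I -> chains K R X) :
  (forall i, A i -> supported P (f i)) -> supported P (\sum_(i <- r | A i) f i).
Proof.
move=> fP; elim/big_ind: _ => //; first exact: supported0.
by move=> x y xP yP; rewrite -[x]scale1r; exact: supported_linear.
Qed.

Lemma supportedZ P (a : R) x : supported P x -> supported P (a *: x).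
Proof. by move=> xP; rewrite -[a *: x]addr0; apply: supported_linear => //; exact: supported0. Qed.

Lemma supported_basis P t : P t -> supported P (Defs.basis R t).
Proof.
move=> Pt u; rewrite -[freemod_fun _ u]/((u == t)%:R : R).
by have [->//|_] := eqVneq u t; rewrite eqxx.
Qed.

Lemma supported_linext P (f : fsimplex K X -> chains K R X) x :
  (forall t, freemod_fun x t != 0 -> supported P (f t)) -> supported P (linext f x).
Proof.
move=> fP; rewrite (@linextE _ _ _ _ _ [set t | freemod_fun x t != 0]%classic) //; last first.
  exact: freemod_finite.
rewrite big_seq; apply: supported_sum => t.
by rewrite in_fset_set ?inE; [move=> /fP; exact: supportedZ|exact: freemod_finite].
Qed.

Lemma supported_weaken P Q x : (forall t, P t -> Q t) -> supported P x -> supported Q x.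
Proof. by move=> PQ xP t /xP/PQ. Qed.

Lemma supported_cap P w x :
  (forall s (c : cell (fs_blk (val s))), freemod_fun x (val s) != 0 -> w s c != 0 ->
     all_capped (block (fs_blk (val s))) (val c) ->
     P (face (join_tail (block (fs_blk (val s))) (val c)))) ->
  supported P (cap w x).
Proof.
move=> wP; rewrite capE; apply: supported_linext => t xt.
have [reg|nreg] := boolP (regular t); last first.
  by rewrite cap_fsimplex_irregular //; exact: supported0.
rewrite (cap_fsimplex_regular w reg) /cap_rsimplex; apply: supported_sum => c _.
set s := exist _ _ _ in c *.
have [->|wc] := eqVneq (w s c) 0; first by rewrite scale0r; exact: supported0.
apply: supportedZ; rewrite cap_cellE; apply: supportedZ; rewrite /tensor_value.
case: ifP => [ac|_]; last exact: supported0.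
by rewrite /face_chain join_tail_regular //; apply: supported_basis; exact: (wP s).
Qed.

Lemma cap_allowable (p q : perversity X) w x : cochain_allowable p w ->
  supported (fun t => regular t /\ simplex_allowable q t) x ->
  supported (fun t => regular t /\ simplex_allowable (perv_add p q) t) (cap w x).
Proof.
move=> /cochain_allowableP wp xq; apply: supported_cap => s c xs wc ac.
split; first exact: join_tail_regular.
apply: cap_face_allowable => //; first by have [] := xq _ xs.
by move=> S sS mS; exact: (wp S s c).
Qed.

Lemma cap_homogeneous (k m : int) w x : homogeneous k w ->
  supported (fun t => fs_dim t = m) x ->
  supported (fun t => fs_dim t = m - k) (cap w x).
Proof.
move=> wk xm; apply: supported_cap => s c xs wc ac.
by rewrite cap_face_dim // (xm _ xs) (wk _ _ wc).
Qed.

Lemma cap_tame (p q : perversity X) (k m : int) w x :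
  w \in blownup_cochains K R p k -> x \in tame_chains K R q m ->
  cap w x \in tame_chains K R (perv_add p q) (m - k).
Proof.
rewrite !inE => -[wC wk wp dwp] [xq dxq]; split.
  have xq' : supported (fun t => regular t /\ simplex_allowable q t) x.
    by apply: supported_weaken xq => t [].
  have xm : supported (fun t => fs_dim t = m) x by apply: supported_weaken xq => t [].
  move=> t xt; have [reg al] := cap_allowable wp xq' xt.
  by split=> //; exact: (cap_homogeneous wk xm).
rewrite (leibniz _ wC wk) addrC; apply: supported_linear; apply: cap_allowable => //.
by apply: supported_weaken xq => t [].
Qed.

Lemma cap0r w : cap w (0 : chains K R X) = 0.
Proof. by rewrite capE linear0. Qed.

Lemma cap0l x : cap (0 : cochains K R X) x = 0.
Proof. by have := cap_linear_l x (-1) 0 0; rewrite scaler0 addr0 scaleN1r addNr. Qed.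

Lemma capBl w w' x : cap (w - w') x = cap w x - cap w' x.
Proof. by rewrite addrC -scaleN1r cap_linear_l scaleN1r addrC. Qed.

Lemma capBr w x y : cap w (x - y) = cap w x - cap w y.
Proof. by rewrite addrC -scaleN1r cap_linear_r scaleN1r addrC. Qed.

Variables (p q : perversity X) (k m : int).

Lemma cap_cycles w x : w \in cocycles K R p k -> x \in cycles K R q m ->
  cap w x \in cycles K R (perv_add p q) (m - k).
Proof.
move=> /cocyclesP[wC dw] /cyclesP[xC dx]; apply/cyclesP; split; first exact: cap_tame.
move: wC; rewrite inE => -[wC wk _ _].
by rewrite (leibniz _ wC wk) dw dx cap0l cap0r scaler0 addr0.
Qed.

Lemma cap_coboundary w x : w \in coboundaries K R p k -> x \in cycles K R q m ->
  cap w x \in boundaries K R (perv_add p q) (m - k).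
Proof.
move=> /coboundariesP[v vC ->] /cyclesP[xC dx]; apply/boundariesP; exists (cap v x).
  by rewrite (_ : m - k + 1 = m - (k - 1)); [exact: cap_tame|lia].
move: vC; rewrite inE => -[vC vk _ _].
by rewrite (leibniz _ vC vk) dx cap0r scaler0 addr0.
Qed.

Lemma cap_boundary w x : w \in cocycles K R p k -> x \in boundaries K R q m ->
  cap w x \in boundaries K R (perv_add p q) (m - k).
Proof.
move=> /cocyclesP[wC dw] /boundariesP[y yC ->]; apply/boundariesP.
(* d (w cap y) = (-1)^k w cap dy because w is a cocycle. *)
exists ((-1) ^+ `|k|%N *: cap w y).
  by rewrite addrAC rpredZ // cap_tame.
move: wC; rewrite inE => -[wC wk _ _].
rewrite -[in RHS](addr0 (_ *: _)) tame_diff_linear linear0 addr0 (leibniz _ wC wk) dw cap0l add0r.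
by rewrite scalerA -exprD addnn -mul2n exprM sqrrN !expr1n scale1r.
Qed.

Lemma val_linear (V : lmodType R) (S : submodClosed V) (a : R) (u v : submod S) :
  submod_val (a *: u + v) = a *: submod_val u + submod_val v.
Proof. exact: (linearP (val : submod S -> V)). Qed.

Definition cap_complex (w : blownup_complex K R p k) (x : tame_complex K R q m) :
    tame_complex K R (perv_add p q) (m - k) := Submod (cap_tame (valP w) (valP x)).

Definition cap_cycle (w : cocycle_module K R p k) (x : cycle_module K R q m) :
    cycle_module K R (perv_add p q) (m - k) := Submod (cap_cycles (valP w) (valP x)).

Definition cap_homology (a : blownup_cohomology K R p k) (b : tame_homology K R q m) :
    tame_homology K R (perv_add p q) (m - k) := homology_class (cap_cycle (repr a) (repr b)).

Lemma cap_complex_bilinear : bilinear_map cap_complex.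
Proof.
split=> [x a w w'|w a x x']; apply/val_inj; rewrite [RHS]val_linear /=.
  by rewrite -cap_linear_l; congr (cap _ _); exact: val_linear.
by rewrite -cap_linear_r; congr (cap _ _); exact: val_linear.
Qed.

Lemma cap_cycle_bilinear : bilinear_map cap_cycle.
Proof.
split=> [x a w w'|w a x x']; apply/val_inj; rewrite [RHS]val_linear /=.
  by rewrite -cap_linear_l; congr (cap _ _); exact: val_linear.
by rewrite -cap_linear_r; congr (cap _ _); exact: val_linear.
Qed.

(** Changing [w] by a coboundary and then [x] by a boundary changes the cap product
    by boundaries. *)
Lemma cap_homologyE (w : cocycle_module K R p k) (x : cycle_module K R q m) :
  cap_homology (cohomology_class w) (homology_class x) = homology_class (cap_cycle w x).
Proof.
apply/subquot_classP => /=; set w' := repr _; set x' := repr _.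
have ww' : submod_val w' - submod_val w \in coboundaries K R p k.
  by apply/subquot_classP; exact: subquot_classK.
have xx' : submod_val x' - submod_val x \in boundaries K R q m.
  by apply/subquot_classP; exact: subquot_classK.
rewrite -(subrKA (cap (submod_val w) (submod_val x'))) -capBl -capBr rpredD //.
  exact: cap_coboundary (valP x').
exact: cap_boundary (valP w) _.
Qed.

Lemma cap_homology_bilinear : bilinear_map cap_homology.
Proof.
have [Ll Lr] := cap_cycle_bilinear.
split=> [b a u v|u a b c].
  elim/subquotW: b => b; elim/subquotW: u => u; elim/subquotW: v => v.
  rewrite -[_ *: _ + _]subquot_class_linear [LHS]cap_homologyE Ll [LHS]subquot_class_linear.
  by congr (_ *: _ + _); rewrite -[LHS]cap_homologyE.
elim/subquotW: b => b; elim/subquotW: u => u; elim/subquotW: c => c.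
rewrite -[_ *: _ + _]subquot_class_linear [LHS]cap_homologyE Lr [LHS]subquot_class_linear.
by congr (_ *: _ + _); rewrite -[LHS]cap_homologyE.
Qed.

End Support.

Theorem proposition6p7 (K : realType) (R : comPzRingType) (X : filtered_space)
    (p q : perversity X) (k m : int) :
  exists f : blownup_complex K R p k -> tame_complex K R q m ->
             tame_complex K R (perv_add p q) (m - k),
    [/\ bilinear_map f,
      forall w x, tame_val (f w x) = cap (blownup_val w) (tame_val x) &
      exists g : blownup_cohomology K R p k -> tame_homology K R q m ->
                 tame_homology K R (perv_add p q) (m - k),
        bilinear_map g /\
        forall (w : cocycle_module K R p k) (x : cycle_module K R q m),
          exists2 z : cycle_module K R (perv_add p q) (m - k),
            cycle_val z = cap (cocycle_val w) (cycle_val x) &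
            g (cohomology_class w) (homology_class x) = homology_class z].
Proof.
exists (@cap_complex K R X p q k m); split=> //; first exact: cap_complex_bilinear.
exists (@cap_homology K R X p q k m); split; first exact: cap_homology_bilinear.
by move=> w x; exists (cap_cycle w x); rewrite // cap_homologyE.
Qed.
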